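(* Let $0<q<1$ and let $\sigma(x)=K\triangleright x$, $K=(K_1K_2)^{-4}$, on $\mathcal A(\mathbb CP^2_q)$. The twisted Hochschild 4-cocycles $$\tau(a_0,\dots,a_4)=-\int_h a_0\,\mathrm da_1\,\mathrm da_2\,\mathrm da_3\,\mathrm da_4$$ and $\varphi=\varphi_1+\varphi_2$, where $$\varphi_1(a_0,\dots,a_4)=-3\int_h a_0\,\partial a_1\,\partial a_2\,\bar\partial a_3\,\bar\partial a_4,\qquad \varphi_2(a_0,\dots,a_4)=-3\int_h a_0\,\bar\partial a_1\,\bar\partial a_2\,\partial a_3\,\partial a_4,$$ are cohomologous, i.e. $\tau-\varphi=b_\sigma\psi$ for some twisted Hochschild 3-cochain $\psi\in C^3_\sigma(\mathcal A(\mathbb CP^2_q))$.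
   Context: Fix $0<q<1$. $U_q(\mathfrak{su}(3))$ is the Hopf $*$-algebra generated by $K_i^{\pm1},E_i,F_i$ ($i=1,2$), $K_i^*=K_i$, $E_i^*=F_i$, with $[K_1,K_2]=0$, $K_iE_i=qE_iK_i$, $[E_i,F_i]=\frac{K_i^2-K_i^{-2}}{q-q^{-1}}$, and for $i\ne j$: $K_iE_j=q^{-1/2}E_jK_i$, $[E_i,F_j]=0$, $E_i^2E_j+E_jE_i^2=(q+q^{-1})E_iE_jE_i$; $\Delta(K_i)=K_i\otimes K_i$, $\Delta(E_i)=E_i\otimes K_i+K_i^{-1}\otimes E_i$, $\Delta(F_i)=F_i\otimes K_i+K_i^{-1}\otimes F_i$; $\epsilon(K_i)=1$, $\epsilon(E_i)=\epsilon(F_i)=0$; $S(K_i)=K_i^{-1}$, $S(E_i)=-qE_i$, $S(F_i)=-q^{-1}F_i$. $\mathcal A(SU_q(3))$ is the Hopf $*$-algebra generated by $u^i_j$ ($i,j=1,2,3$) with $u^i_ku^j_k=qu^j_ku^i_k$ and $u^k_iu^k_j=qu^k_ju^k_i$ for $i<j$; $[u^i_l,u^j_k]=0$ and $[u^i_k,u^j_l]=(q-q^{-1})u^i_lu^j_k$ for $i<j$, $k<l$; $\sum_{\pi\in S_3}(-q)^{\ell(\pi)}u^1_{\pi(1)}u^2_{\pi(2)}u^3_{\pi(3)}=1$; $(u^i_j)^*=(-q)^{j-i}(u^{k_1}_{l_1}u^{k_2}_{l_2}-qu^{k_1}_{l_2}u^{k_2}_{l_1})$, where $\{k_1<k_2\}=\{1,2,3\}\setminus\{i\}$,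 $\{l_1<l_2\}=\{1,2,3\}\setminus\{j\}$; $\Delta(u^i_j)=\sum_ku^i_k\otimes u^k_j$. It carries commuting left and right actions of $U_q(\mathfrak{su}(3))$ with $h\triangleright(ab)=(h_{(1)}\triangleright a)(h_{(2)}\triangleright b)$, $(ab)\triangleleft h=(a\triangleleft h_{(1)})(b\triangleleft h_{(2)})$, $(h\triangleright a)^*=S(h)^*\triangleright a^*$, $(a\triangleleft h)^*=a^*\triangleleft S(h)^*$, units acted on through $\epsilon$, and $K_i\triangleright u^j_k=q^{\frac12(\delta_{i+1,k}-\delta_{i,k})}u^j_k$, $E_i\triangleright u^j_k=\delta_{i,k}u^j_{i+1}$, $F_i\triangleright u^j_k=\delta_{i+1,k}u^j_i$, $u^j_k\triangleleft K_i=q^{\frac12(\delta_{i+1,j}-\delta_{i,j})}u^j_k$, $u^j_k\triangleleft E_i=\delta_{i+1,j}u^i_k$, $u^j_k\triangleleft F_i=\delta_{i,j}u^{i+1}_k$. $\mathcal A(S^5_q)=\{a: a\triangleleft h=\epsilon(h)a$ for $h$ in the subalgebra generated by $K_1^{\pm1},E_1,F_1\}$; $\mathcal A:=\mathcal A(\mathbb CP^2_q)=\{a\in\mathcal A(S^5_q):a\triangleleft K_1K_2^2=a\}$. Calculus. $\Omega^{(1,0)}$ (resp. $\Omega^{(0,1)}$) is the $\mathcal A$-bimodule (componentwise multiplication) of pairs $(v_+,v_-)\in\mathcal A(SU_q(3))^2$ with $(v_+,v_-)\triangleleft K_1=(q^{1/2}v_+,q^{-1/2}v_-)$, $(v_+,v_-)\triangleleft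 F_1=(0,v_+)$, $(v_+,v_-)\triangleleft E_1=(v_-,0)$, and $(v_+,v_-)\triangleleft K_1K_2^2=q^{-3/2}(v_+,v_-)$ (resp. $q^{3/2}(v_+,v_-)$). Up to multiplicative constants, $\partial a=(a\triangleleft E_2,\ a\triangleleft E_2E_1)$, $\bar\partial a=(a\triangleleft F_2F_1,\ a\triangleleft F_2)$, and $\mathrm d=\partial+\bar\partial$. The differential $*$-calculus $\Omega^\bullet=\bigoplus\Omega^{(p,q)}$ ($0\le p,q\le2$) is generated by $\Omega^1=\Omega^{(1,0)}\oplus\Omega^{(0,1)}$; it is the maximal prolongation, i.e. the quotient of the tensor algebra $T_{\mathcal A}(\Omega^1)$ by the ideal generated by all $\sum_i\mathrm da_i\otimes\mathrm db_i$ with $\sum_ia_i\,\mathrm db_i=0$. The maps $\partial,\bar\partial$ have bidegree $(1,0)$, $(0,1)$, satisfy the graded Leibniz rule, and $\partial^2=\bar\partial^2=\partial\bar\partial+\bar\partial\partial=0$. The left action of $U_q(\mathfrak{su}(3))$ extends to $\Omega^\bullet$ compatibly with products and commutes with $\partial,\bar\partial$. $\Omega^{(2,2)}$ is a free rank-one $\mathcal A$-module with a basis element $\omega$ that is central ($\omega a=a\omega$) and invariant under the left action. Integral. $h$ is the Haar state of $\mathcal A(SU_q(3))$ (the unique invariant state), satisfying $h(xy)=h(\sigma(y)x)$ for $\sigma(x)=K\triangleright x\triangleleft K$, $K=(K_1K_2)^{-4}$; on $\mathcal A$, $\sigma(x)=K\triangleright x$. Define $\int_h x\omega=h(x)$ for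 $x\in\mathcal A$, so $\int_h:\Omega^{(2,2)}=\Omega^4\to\mathbb C$. Twisted Hochschild cohomology. $C^n_\sigma(\mathcal A)=\ker(1-\lambda_\sigma^{n+1})\subset\mathrm{Hom}(\mathcal A^{\otimes(n+1)},\mathbb C)$, where $(\lambda_\sigma\phi)(a_0,\dots,a_n)=(-1)^n\phi(\sigma(a_n),a_0,\dots,a_{n-1})$; $b_\sigma\phi(a_0,\dots,a_{n+1})=\sum_{i=0}^n(-1)^i\phi(a_0,\dots,a_ia_{i+1},\dots,a_{n+1})+(-1)^{n+1}\phi(\sigma(a_{n+1})a_0,\dots,a_n)$. A twisted Hochschild $n$-cocycle is $\phi\in C^n_\sigma(\mathcal A)$ with $b_\sigma\phi=0$. *)

(* Defs.v *)
From HB Require Import structures.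
From mathcomp Require Import all_boot all_order all_fingroup all_algebra.
From mathcomp Require Import generic_quotient.
From mathcomp Require Import boolp classical_sets reals complex finmap.
From mathcomp.multinomials Require Import monalg.

Set Implicit Arguments.
Unset Strict Implicit.
Unset Printing Implicit Defensive.

Import Order.TTheory GRing.Theory Num.Theory.

Local Open Scope ring_scope.

Section FreeAlgebra.
Variables (K : comNzRingType) (X : choiceType).

Definition freealg : Type := {malg K[{fmonom X}]}.
HB.instance Definition _ := GRing.Lalgebra.on freealg.

Definition fgen (x : X) : freealg := mkmalgU (fmu x) 1.

Fact freealg_scalerAr (c : K) (x y : freealg) : c *: (x * y) = x * (c *: y).
Proof.
rewrite [_ * (_ *: _)](malgMEw (fsubset_refl _) (msuppZ_le c y)).
rewrite [x * y]malgME scaler_sumr.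
apply: eq_bigr => k1 _; rewrite scaler_sumr; apply: eq_bigr => k2 _.
rewrite -[LHS]mul_malgC malgM_def; apply: etrans (fgmulUU _ _ _ _) _.
by rewrite mul1m mulrCA mcoeffZ.
Qed.

HB.instance Definition _ :=
  GRing.Lalgebra_isAlgebra.Build K freealg freealg_scalerAr.

Section Evaluation.
Variables (B : algType K) (f : X -> B).

Definition freealg_eval (g : freealg) : B :=
  mmap (in_alg B) (fun m : {fmonom X} => \prod_(x <- m) f x) g.

Let feval := freealg_eval.

Fact freealg_evalU c m : feval (mkmalgU m c) = c *: \prod_(x <- m) f x.
Proof. by rewrite /feval /freealg_eval mmapU /= mulr_algl. Qed.

Fact freealg_eval_sum (T : Type) (s : seq T) (F : T -> freealg) :
  feval (\sum_(t <- s) F t) = \sum_(t <- s) feval (F t).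
Proof. exact: (raddf_sum (mmap (in_alg B) _)). Qed.

Fact freealg_evalB x y : feval (x - y) = feval x - feval y.
Proof. exact: mmapB. Qed.

Fact freealg_eval1 : feval 1 = 1.
Proof. by rewrite [LHS]freealg_evalU fm1 big_nil scale1r. Qed.

Fact freealg_evalM x y : feval (x * y) = feval x * feval y.
Proof.
rewrite [x * y]malgME [in RHS]/feval /freealg_eval /mmap mulr_suml.
rewrite [LHS]freealg_eval_sum; apply: eq_bigr => k1 _.
rewrite [LHS]freealg_eval_sum mulr_sumr; apply: eq_bigr => k2 _.
rewrite [LHS]freealg_evalU fmM big_cat /= !mulr_algl.
by rewrite -scalerAl -scalerAr scalerA.
Qed.

Fact freealg_evalZ c x : feval (c *: x) = c *: feval x.
Proof.
rewrite -[c *: x]mul_malgC [LHS]freealg_evalM [feval c%:MP]freealg_evalU.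
by rewrite fm1 big_nil mulr_algl.
Qed.

Fact freealg_eval_gen x : feval (fgen x) = f x.
Proof. by rewrite [LHS]freealg_evalU fmU big_seq1 scale1r. Qed.

HB.instance Definition _ :=
  GRing.isZmodMorphism.Build freealg B freealg_eval freealg_evalB.
HB.instance Definition _ :=
  GRing.isMonoidMorphism.Build freealg B freealg_eval
    (freealg_eval1, freealg_evalM).
HB.instance Definition _ :=
  GRing.isScalable.Build K freealg B *:%R freealg_eval freealg_evalZ.

End Evaluation.
End FreeAlgebra.

Section IdealQuotient.
Variables (K : comNzRingType) (F : algType K).

(* The two-sided ideal generated by the differences x - y with rel x y.       *)
Inductive rel_ideal (rel : F -> F -> Prop) : F -> Prop :=
| Ideal_rel x y of rel x y : rel_ideal rel (x - y)
| Ideal0 : rel_ideal rel 0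
| IdealB x y of rel_ideal rel x & rel_ideal rel y : rel_ideal rel (x - y)
| IdealMl a x of rel_ideal rel x : rel_ideal rel (a * x)
| IdealMr x a of rel_ideal rel x : rel_ideal rel (x * a).

Lemma rel_ideal_ker (rel : F -> F -> Prop) (B : algType K)
    (f : {lrmorphism F -> B}) :
  (forall x y, rel x y -> f x = f y) -> forall x, rel_ideal rel x -> f x = 0.
Proof.
move=> frel x; elim=> {x} [x y /frel fxy||x y _ fx _ fy|a x _ fx|x a _ fx].
- by rewrite rmorphB /= fxy subrr.
- by rewrite rmorph0.
- by rewrite rmorphB /= fx fy subrr.
- by rewrite rmorphM /= fx mulr0.
- by rewrite rmorphM /= fx mul0r.
Qed.

(* MathComp algebras are nonzero, so the ideal has to be proper.              *)
Record proper_rel := ProperRel {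
  pr_rel :> F -> F -> Prop;
  pr_proper : ~ rel_ideal pr_rel 1 }.

Lemma proper_ker (rel : F -> F -> Prop) (B : algType K)
    (f : {lrmorphism F -> B}) :
  (forall x y, rel x y -> f x = f y) -> ~ rel_ideal rel 1.
Proof.
by move=> frel /(rel_ideal_ker frel)/eqP; rewrite rmorph1 oner_eq0.
Qed.

Variable rel : proper_rel.
Let I := rel_ideal rel.

Let idealN x : I x -> I (- x).
Proof. by move=> Ix; rewrite -sub0r; apply: IdealB Ix; apply: Ideal0. Qed.

Let idealD x y : I x -> I y -> I (x + y).
Proof. by move=> Ix Iy; rewrite -[y]opprK; apply: IdealB Ix (idealN Iy). Qed.

Definition quot_eq (x y : F) : bool := `[< I (x - y) >].

Fact quot_eq_equiv : equiv_class_of quot_eq.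
Proof.
split=> [x | x y | y x z].
- by apply/asboolP; rewrite subrr; apply: Ideal0.
- by apply/asboolP/asboolP => /idealN; rewrite opprB.
- move=> /asboolP Ixy /asboolP Iyz; apply/asboolP.
  by rewrite -[x](subrK y) -addrA; apply: idealD.
Qed.

Canonical quot_equiv := EquivRelPack quot_eq_equiv.

Definition quotalg : Type := {eq_quot quot_eq}%qT.

HB.instance Definition _ := Choice.on quotalg.
HB.instance Definition _ := EqQuotient.on quotalg.

Definition quot_pi (x : F) : quotalg := \pi_quotalg%qT x.

Fact quot_piP x y : quot_pi x = quot_pi y <-> I (x - y).
Proof.
split=> [/eqquotP/asboolP // | Ixy].
by apply/eqquotP/asboolP.
Qed.

Fact quot_pi_repr (a : quotalg) : quot_pi (repr a) = a.
Proof. exact: reprK. Qed.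

(* The operations are locked: unfolding them down to monoid algebras is very  *)
(* expensive.                                                                 *)
Fact quot_key : unit. Proof. by []. Qed.
Definition quot_zero : quotalg := locked_with quot_key (quot_pi 0).
Definition quot_one : quotalg := locked_with quot_key (quot_pi 1).
Definition quot_add := locked_with quot_key
  (fun a b : quotalg => quot_pi (repr a + repr b)).
Definition quot_opp := locked_with quot_key
  (fun a : quotalg => quot_pi (- repr a)).
Definition quot_mul := locked_with quot_key
  (fun a b : quotalg => quot_pi (repr a * repr b)).
Definition quot_scale := locked_with quot_key
  (fun (c : K) (a : quotalg) => quot_pi (c *: repr a)).

Let reprI x : I (repr (quot_pi x) - x).
Proof. by apply/quot_piP; rewrite quot_pi_repr. Qed.

Fact quot_piD x y : quot_add (quot_pi x) (quot_pi y) = quot_pi (x + y).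
Proof.
rewrite /quot_add locked_withE; apply/quot_piP; rewrite opprD addrACA.
exact: idealD (reprI x) (reprI y).
Qed.

Fact quot_piN x : quot_opp (quot_pi x) = quot_pi (- x).
Proof.
rewrite /quot_opp locked_withE; apply/quot_piP.
by rewrite -opprD; exact: idealN (reprI x).
Qed.

Fact quot_piM x y : quot_mul (quot_pi x) (quot_pi y) = quot_pi (x * y).
Proof.
rewrite /quot_mul locked_withE; apply/quot_piP.
set x' := repr _; set y' := repr _.
have ->: x' * y' - x * y = (x' - x) * y' + x * (y' - y).
  by rewrite mulrBl mulrBr addrA subrK.
by apply: idealD; [exact: IdealMr (reprI x) | exact: IdealMl (reprI y)].
Qed.

Fact quot_piZ c x : quot_scale c (quot_pi x) = quot_pi (c *: x).
Proof.
rewrite /quot_scale locked_withE; apply/quot_piP.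
by rewrite -scalerBr -mulr_algl; exact: IdealMl (reprI x).
Qed.

Fact quot_pi0 : quot_zero = quot_pi 0. Proof. exact: locked_withE. Qed.
Fact quot_pi1 : quot_one = quot_pi 1. Proof. exact: locked_withE. Qed.

Let quotE := (quot_pi0, quot_pi1, quot_piD, quot_piN, quot_piM, quot_piZ).

Let quotW (Q : quotalg -> Prop) : (forall x, Q (quot_pi x)) -> forall a, Q a.
Proof. by move=> Qpi a; rewrite -[a]quot_pi_repr. Qed.

Fact quot_addA : associative quot_add.
Proof. by do 3![elim/quotW=> ?]; rewrite !quotE addrA. Qed.
Fact quot_addC : commutative quot_add.
Proof. by do 2![elim/quotW=> ?]; rewrite !quotE addrC. Qed.
Fact quot_add0 : left_id quot_zero quot_add.
Proof. by elim/quotW=> ?; rewrite !quotE add0r. Qed.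
Fact quot_addN : left_inverse quot_zero quot_opp quot_add.
Proof. by elim/quotW=> ?; rewrite !quotE addNr. Qed.

HB.instance Definition _ :=
  GRing.isZmodule.Build quotalg quot_addA quot_addC quot_add0 quot_addN.

Fact quot_mulA : associative quot_mul.
Proof. by do 3![elim/quotW=> ?]; rewrite !quotE mulrA. Qed.
Fact quot_mul1l : left_id quot_one quot_mul.
Proof. by elim/quotW=> ?; rewrite !quotE mul1r. Qed.
Fact quot_mul1r : right_id quot_one quot_mul.
Proof. by elim/quotW=> ?; rewrite !quotE mulr1. Qed.
Fact quot_mulDl : left_distributive quot_mul quot_add.
Proof. by do 3![elim/quotW=> ?]; rewrite !quotE mulrDl. Qed.
Fact quot_mulDr : right_distributive quot_mul quot_add.
Proof. by do 3![elim/quotW=> ?]; rewrite !quotE mulrDr. Qed.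
Fact quot_1neq0 : quot_one != quot_zero.
Proof. by rewrite !quotE; apply/eqP => /quot_piP; rewrite subr0; apply: pr_proper. Qed.

HB.instance Definition _ := GRing.Zmodule_isNzRing.Build quotalg
  quot_mulA quot_mul1l quot_mul1r quot_mulDl quot_mulDr quot_1neq0.

Fact quot_scaleA a b v : quot_scale a (quot_scale b v) = quot_scale (a * b) v.
Proof. by elim/quotW: v => ?; rewrite !quotE scalerA. Qed.
Fact quot_scale1 : left_id 1 quot_scale.
Proof. by elim/quotW=> ?; rewrite !quotE scale1r. Qed.
Fact quot_scaleDr : right_distributive quot_scale quot_add.
Proof. by move=> c; do 2![elim/quotW=> ?]; rewrite !quotE scalerDr. Qed.
Fact quot_scaleDl v a b :
  quot_scale (a + b) v = quot_add (quot_scale a v) (quot_scale b v).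
Proof. by elim/quotW: v => ?; rewrite !quotE scalerDl. Qed.

HB.instance Definition _ := GRing.Zmodule_isLmodule.Build K quotalg
  quot_scaleA quot_scale1 quot_scaleDr quot_scaleDl.

Fact quot_scaleAl c a b :
  quot_scale c (quot_mul a b) = quot_mul (quot_scale c a) b.
Proof. by elim/quotW: a => ?; elim/quotW: b => ?; rewrite !quotE scalerAl. Qed.

HB.instance Definition _ :=
  GRing.Lmodule_isLalgebra.Build K quotalg quot_scaleAl.

Fact quot_scaleAr c a b :
  quot_scale c (quot_mul a b) = quot_mul a (quot_scale c b).
Proof. by elim/quotW: a => ?; elim/quotW: b => ?; rewrite !quotE scalerAr. Qed.

HB.instance Definition _ :=
  GRing.Lalgebra_isAlgebra.Build K quotalg quot_scaleAr.

Fact quot_pi_zmod_morphism : zmod_morphism quot_pi.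
Proof.
move=> x y; apply/esym.
by rewrite -[LHS]/(quot_add _ (quot_opp _)) quot_piN quot_piD.
Qed.
HB.instance Definition _ :=
  GRing.isZmodMorphism.Build F quotalg quot_pi quot_pi_zmod_morphism.

Fact quot_pi_monoid_morphism : monoid_morphism quot_pi.
Proof. by split=> [|x y]; apply/esym; [exact: quot_pi1 | exact: quot_piM]. Qed.
HB.instance Definition _ :=
  GRing.isMonoidMorphism.Build F quotalg quot_pi quot_pi_monoid_morphism.

Fact quot_pi_scalable : scalable quot_pi.
Proof. by move=> c x; apply/esym/quot_piZ. Qed.
HB.instance Definition _ :=
  GRing.isScalable.Build K F quotalg *:%R quot_pi quot_pi_scalable.

Lemma quot_pi_rel x y : rel x y -> quot_pi x = quot_pi y.
Proof. by move=> rxy; apply/quot_piP; apply: Ideal_rel. Qed.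

(* The factorization through the quotient of a morphism f that respects the   *)
(* relations.                                                                 *)
Definition quot_lift (B : algType K) (f : F -> B) (a : quotalg) : B :=
  f (repr a).

Lemma quot_liftE (B : algType K) (f : {lrmorphism F -> B}) :
    (forall x y, rel x y -> f x = f y) ->
  forall x, quot_lift f (quot_pi x) = f x.
Proof.
move=> frel x; apply/eqP; rewrite -subr_eq0 -rmorphB; apply/eqP.
exact: rel_ideal_ker frel _ (reprI x).
Qed.

Lemma quot_lift_is_lrmorphism (B : algType K) (f : {lrmorphism F -> B}) :
    (forall x y, rel x y -> f x = f y) ->
  [/\ zmod_morphism (quot_lift f), monoid_morphism (quot_lift f)
    & scalable (quot_lift f)].
Proof.
move=> frel; have fE := quot_liftE frel; split=> [a b||c a].
- elim/quotW: a => x; elim/quotW: b => y.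
  by rewrite -rmorphB !fE rmorphB.
- split=> [|a b]; first by rewrite -(rmorph1 (quot_pi)) fE rmorph1.
  elim/quotW: a => x; elim/quotW: b => y.
  by rewrite -rmorphM !fE rmorphM.
- elim/quotW: a => x.
  by rewrite -linearZ !fE linearZ.
Qed.

End IdealQuotient.

Section Presentation.
Variables (K : comNzRingType) (X : choiceType) (rel : proper_rel (freealg K X)).

Definition presgen : X -> quotalg rel :=
  locked_with quot_key (fun x => quot_pi rel (fgen K x)).

Lemma presgenE x : presgen x = quot_pi rel (fgen K x).
Proof. by rewrite /presgen locked_withE. Qed.

End Presentation.

Section TwistedHochschild.
Variables (K : comNzRingType) (A : algType K) (sigma : A -> A).

(* A cochain phi(a_0, ..., a_n), as a function of the family of its arguments *)
Definition cochain (n : nat) := ('I_n.+1 -> A) -> K.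

Definition multilinear n (phi : cochain n) : Prop :=
  forall (i : 'I_n.+1) (a : 'I_n.+1 -> A) (c : K) (x y : A),
    phi [eta a with i |-> c *: x + y] =
    c * phi [eta a with i |-> x] + phi [eta a with i |-> y].

Definition lambda_sigma n (phi : cochain n) : cochain n :=
  fun a => (-1) ^+ n *
    phi (fun j => if j == ord0 then sigma (a ord_max) else a (inord j.-1)).

Definition b_sigma n (phi : cochain n) : cochain n.+1 :=
  fun a =>
    \sum_(i < n.+1) (-1) ^+ i *
      phi (fun j : 'I_n.+1 =>
             if (j < i)%N then a (inord j)
             else if j == i then a (inord i) * a (inord i.+1)
             else a (inord j.+1))
    + (-1) ^+ n.+1 *
      phi (fun j : 'I_n.+1 =>
             if j == ord0 then sigma (a ord_max) * a ord0 else a (inord j)).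

(* C^n_sigma(A) = ker (1 - lambda_sigma^{n+1})                                *)
Definition twisted_cochain n (phi : cochain n) : Prop :=
  multilinear phi /\ forall a, phi a - iter n.+1 (@lambda_sigma n) phi a = 0.

Definition twisted_cocycle n (phi : cochain n) : Prop :=
  twisted_cochain phi /\ forall a, b_sigma phi a = 0.

End TwistedHochschild.

Section QuantumSU3.
Variables (R : realType) (q : R).
Local Notation C := R[i].
Local Notation qC := (q%:C%C : C).
Local Notation q_half := ((Num.sqrt q)%:C%C : C).

(* The indices 1, 2 (resp. 1, 2, 3) are the elements 0, 1 of 'I_2 (resp.      *)
(* 0, 1, 2 of 'I_3); for i : 'I_2, the index i (resp. i + 1) of 'I_3 is       *)
(* lo i (resp. hi i).                                                         *)
Definition lo (i : 'I_2) : 'I_3 := widen_ord (leqnSn 2) i.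
Definition hi (i : 'I_2) : 'I_3 := lift ord0 i.

Inductive Uq_gen :=
  GenK of 'I_2 | GenKinv of 'I_2 | GenE of 'I_2 | GenF of 'I_2.
HB.instance Definition _ := gen_eqMixin Uq_gen.
HB.instance Definition _ := gen_choiceMixin Uq_gen.

Section Relations.
Variable A : algType C.

Section UqRelation.
Variables K Kinv E F : 'I_2 -> A.

(* The relations UqKF, UqKF' and UqSerreF are the adjoints of UqKE, UqKE' and *)
(* UqSerreE under the involution K_i^* = K_i, E_i^* = F_i.                    *)
Inductive Uq_relation : A -> A -> Prop :=
| UqKV i : Uq_relation (K i * Kinv i) 1
| UqVK i : Uq_relation (Kinv i * K i) 1
| UqKK i j : Uq_relation (K i * K j) (K j * K i)
| UqKE i : Uq_relation (K i * E i) (qC *: (E i * K i))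
| UqKE' i j of i != j : Uq_relation (K i * E j) (q_half^-1 *: (E j * K i))
| UqKF i : Uq_relation (F i * K i) (qC *: (K i * F i))
| UqKF' i j of i != j : Uq_relation (F j * K i) (q_half^-1 *: (K i * F j))
| UqEF i : Uq_relation (E i * F i - F i * E i)
                       ((qC - qC^-1)^-1 *: (K i ^+ 2 - Kinv i ^+ 2))
| UqEF' i j of i != j : Uq_relation (E i * F j - F j * E i) 0
| UqSerreE i j of i != j :
    Uq_relation (E i ^+ 2 * E j + E j * E i ^+ 2)
                ((qC + qC^-1) *: (E i * E j * E i))
| UqSerreF i j of i != j :
    Uq_relation (F j * F i ^+ 2 + F i ^+ 2 * F j)
                ((qC + qC^-1) *: (F i * F j * F i)).
End UqRelation.

Definition perm_length (s : 'S_3) : nat :=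
  #|[set p : 'I_3 * 'I_3 | (p.1 < p.2)%N && (s p.2 < s p.1)%N]|.

Section SURelation.
Variable u : 'I_3 -> 'I_3 -> A.

Inductive SU_relation : A -> A -> Prop :=
| SU_col (i j k : 'I_3) of (i < j)%N :
    SU_relation (u i k * u j k) (qC *: (u j k * u i k))
| SU_row (i j k : 'I_3) of (i < j)%N :
    SU_relation (u k i * u k j) (qC *: (u k j * u k i))
| SU_comm (i j k l : 'I_3) of (i < j)%N & (k < l)%N :
    SU_relation (u i l * u j k) (u j k * u i l)
| SU_cross (i j k l : 'I_3) of (i < j)%N & (k < l)%N :
    SU_relation (u i k * u j l - u j l * u i k)
                ((qC - qC^-1) *: (u i l * u j k))
| SU_det :
    SU_relation (\sum_(s : 'S_3) (- qC) ^+ perm_length s *: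
                   (u 0 (s 0) * u 1 (s 1) * u 2 (s 2))) 1.

End SURelation.

(* The counits send K_i to 1, E_i and F_i to 0, and u^i_j to 1 if i = j and   *)
(* to 0 otherwise; here they show that the presented algebras are nonzero.    *)
Lemma Uq_counit_rel (K Kinv E F : 'I_2 -> A) (f : {lrmorphism A -> C^o}) :
    (forall i, f (K i) = 1) -> (forall i, f (Kinv i) = 1) ->
    (forall i, f (E i) = 0) -> (forall i, f (F i) = 0) ->
  forall x y, Uq_relation K Kinv E F x y -> f x = f y.
Proof.
move=> fK fKi fE fF x y.
case=> [i|i|i j|i|i j _|i|i j _|i|i j _|i j _|i j _].
- by rewrite rmorphM rmorph1 /= fK fKi mulr1.
- by rewrite rmorphM rmorph1 /= fK fKi mulr1.
- by rewrite !rmorphM /= !fK.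
- by rewrite linearZ !rmorphM /= !fE !mulr0 mul0r scaler0.
- by rewrite linearZ !rmorphM /= !fE !mulr0 mul0r scaler0.
- by rewrite linearZ !rmorphM /= !fF !mulr0 mul0r scaler0.
- by rewrite linearZ !rmorphM /= !fF !mulr0 mul0r scaler0.
- rewrite linearZ !rmorphB !rmorphM /= fK fKi fE fF.
  by rewrite mulr0 !subrr scaler0.
- by rewrite rmorphB !rmorphM rmorph0 /= fE fF !mul0r subrr.
- by rewrite linearZ rmorphD !rmorphM /= fE fE !(mul0r, mulr0) addr0 scaler0.
- by rewrite linearZ rmorphD !rmorphM /= fF fF !(mul0r, mulr0) addr0 scaler0.
Qed.

Lemma SU_counit_rel (u : 'I_3 -> 'I_3 -> A) (f : {lrmorphism A -> C^o}) :
    (forall i j, f (u i j) = (i == j)%:R) ->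
  forall x y, SU_relation u x y -> f x = f y.
Proof.
move=> fu.
have neq (i j : 'I_3) : (i < j)%N -> (i == j) = false.
  by move=> ltij; apply/eqP => eqij; rewrite eqij ltnn in ltij.
have neq2 (i j k : 'I_3) : (i < j)%N -> (i == k)%:R * (j == k)%:R = 0 :> C^o.
  move=> /neq; have [<-|_ _] := eqVneq i k; last by rewrite mul0r.
  by rewrite eq_sym => ->; rewrite mulr0.
have neq4 (i j k l : 'I_3) : (i < j)%N -> (k < l)%N ->
    (i == l)%:R * (j == k)%:R = 0 :> C^o.
  move=> ltij ltkl; have [eil|_] := eqVneq i l; last by rewrite mul0r.
  have [ejk|_] := eqVneq j k; last by rewrite mulr0.
  by rewrite eil ejk in ltij; have := ltn_trans ltij ltkl; rewrite ltnn.
move=> x y; case=> [i j k ltij|i j k ltij|i j k l ltij ltkl|i j k l ltij ltkl|].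
- by rewrite linearZ !rmorphM /= !fu /= [X in _ *: X]mulrC !neq2 // scaler0.
- rewrite linearZ !rmorphM /= !fu /= ![k == _]eq_sym [X in _ *: X]mulrC !neq2 //.
  by rewrite scaler0.
- by rewrite !rmorphM /= !fu /= [RHS]mulrC neq4.
- by rewrite linearZ rmorphB !rmorphM /= !fu (neq4 i j k l) // scaler0 mulrC subrr.
rewrite rmorph1 linear_sum (bigD1 (1%g : 'S_3)) //= big1 => [|s sN1].
  rewrite addr0 linearZ !rmorphM /= !fu !perm1 !eqxx /= !mulr1.
  suff ->: perm_length 1%g = 0%N by rewrite expr0 scale1r.
  rewrite /perm_length; apply/eqP; rewrite cards_eq0; apply/eqP/setP => p.
  by rewrite !inE !perm1; case: ltngtP.
rewrite linearZ !rmorphM /= !fu /=.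
have [e0|_] := eqVneq 0 (s 0); last by rewrite !mul0r scaler0.
have [e1|_] := eqVneq 1 (s 1); last by rewrite mulr0 mul0r scaler0.
have [e2|_] := eqVneq 2 (s 2); last by rewrite mulr0 scaler0.
case/eqP: sN1; apply/permP => i; rewrite perm1.
case: i => -[|[|[|//]]] lti.
- by rewrite (_ : Ordinal lti = 0) //; apply/val_inj.
- by rewrite (_ : Ordinal lti = 1) //; apply/val_inj.
- by rewrite (_ : Ordinal lti = 2) //; apply/val_inj.
Qed.

End Relations.

Lemma Uq_relation_image (A B : algType C) (f : {lrmorphism A -> B})
    (K Kinv E F : 'I_2 -> A) :
    (forall x y, Uq_relation K Kinv E F x y -> f x = f y) ->
  forall x y, Uq_relation (f \o K) (f \o Kinv) (f \o E) (f \o F) x y -> x = y.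
Proof.
move=> fR x y.
case=> [i|i|i j|i|i j ij|i|i j ij|i|i j ij|i j ij|i j ij] /=.
- by have := fR _ _ (UqKV _ _ _ _ i); rewrite rmorphM rmorph1.
- by have := fR _ _ (UqVK _ _ _ _ i); rewrite rmorphM rmorph1.
- by have := fR _ _ (UqKK _ _ _ _ i j); rewrite !rmorphM.
- by have := fR _ _ (UqKE _ _ _ _ i); rewrite linearZ !rmorphM.
- by have := fR _ _ (UqKE' _ _ _ _ ij); rewrite linearZ !rmorphM.
- by have := fR _ _ (UqKF _ _ _ _ i); rewrite linearZ !rmorphM.
- by have := fR _ _ (UqKF' _ _ _ _ ij); rewrite linearZ !rmorphM.
- have := fR _ _ (UqEF _ _ _ _ i).
  by rewrite linearZ !rmorphB !rmorphM.
- have := fR _ _ (UqEF' _ _ _ _ ij).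
  by rewrite rmorphB !rmorphM rmorph0.
- have := fR _ _ (UqSerreE _ _ _ _ ij).
  by rewrite linearZ rmorphD !rmorphM.
- have := fR _ _ (UqSerreF _ _ _ _ ij).
  by rewrite linearZ rmorphD !rmorphM.
Qed.

Definition Uq_counit_gen (g : Uq_gen) : C^o :=
  match g with GenK _ | GenKinv _ => 1 | GenE _ | GenF _ => 0 end.

Definition Uq_free_relation := @Uq_relation (freealg C Uq_gen)
  (fun i => fgen C (GenK i)) (fun i => fgen C (GenKinv i))
  (fun i => fgen C (GenE i)) (fun i => fgen C (GenF i)).

Fact Uq_proper : ~ rel_ideal Uq_free_relation 1.
Proof.
apply: (@proper_ker _ _ _ _ (freealg_eval Uq_counit_gen)).
by apply: Uq_counit_rel => i; apply: freealg_eval_gen.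
Qed.

Definition Uq_pres := ProperRel Uq_proper.
Definition Uq := quotalg Uq_pres.
HB.instance Definition _ := GRing.Algebra.on Uq.

Definition Ugen (g : Uq_gen) : Uq := presgen Uq_pres g.
Definition UK i := Ugen (GenK i).
Definition UKinv i := Ugen (GenKinv i).
Definition UE i := Ugen (GenE i).
Definition UF i := Ugen (GenF i).

Lemma Uq_relP x y : Uq_relation UK UKinv UE UF x y -> x = y.
Proof.
have UE_ T (c : T -> Uq_gen) :
    (fun i => Ugen (c i)) = quot_pi Uq_pres \o (fun i => fgen C (c i)).
  by apply/funext => i; apply: presgenE.
rewrite [UK]UE_ [UKinv]UE_ [UE]UE_ [UF]UE_.
apply: (@Uq_relation_image _ _ (quot_pi Uq_pres)) => {}x {}y.
exact: (@quot_pi_rel _ _ Uq_pres).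
Qed.

Definition counit (h : Uq) : C^o := quot_lift (freealg_eval Uq_counit_gen) h.

Fact counit_rel x y : Uq_pres x y ->
  freealg_eval Uq_counit_gen x = freealg_eval Uq_counit_gen y.
Proof. by apply: Uq_counit_rel => i; apply: freealg_eval_gen. Qed.

Fact counit_zmod_morphism : zmod_morphism counit.
Proof. by have [] := quot_lift_is_lrmorphism counit_rel. Qed.
Fact counit_monoid_morphism : monoid_morphism counit.
Proof. by have [] := quot_lift_is_lrmorphism counit_rel. Qed.
Fact counit_scalable : scalable counit.
Proof. by have [] := quot_lift_is_lrmorphism counit_rel. Qed.

HB.instance Definition _ :=
  GRing.isZmodMorphism.Build Uq C^o counit counit_zmod_morphism.
HB.instance Definition _ :=
  GRing.isMonoidMorphism.Build Uq C^o counit counit_monoid_morphism.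
HB.instance Definition _ :=
  GRing.isScalable.Build C Uq C^o *:%R counit counit_scalable.

Lemma counit_gen g : counit (Ugen g) = Uq_counit_gen g.
Proof.
rewrite /Ugen presgenE.
exact: etrans (quot_liftE counit_rel _) (freealg_eval_gen _ _).
Qed.

(* The coproduct of a generator, as the list of its simple tensors.           *)
Definition coproduct_gen (g : Uq_gen) : seq (Uq * Uq) :=
  match g with
  | GenK i => [:: (UK i, UK i)]
  | GenKinv i => [:: (UKinv i, UKinv i)]
  | GenE i => [:: (UE i, UK i); (UKinv i, UE i)]
  | GenF i => [:: (UF i, UK i); (UKinv i, UF i)]
  end.

(* S(g)^* for a generator g.                                                  *)
Definition star_antipode_gen (g : Uq_gen) : Uq :=
  match g with
  | GenK i => UKinv i
  | GenKinv i => UK i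
  | GenE i => - qC *: UF i
  | GenF i => - qC^-1 *: UE i
  end.

Definition SU_counit_gen (ij : 'I_3 * 'I_3) : C^o := (ij.1 == ij.2)%:R.

Definition SU_free_relation :=
  @SU_relation (freealg C ('I_3 * 'I_3)%type) (fun i j => fgen C (i, j)).

Fact SU_proper : ~ rel_ideal SU_free_relation 1.
Proof.
apply: (@proper_ker _ _ _ _ (freealg_eval SU_counit_gen)).
by apply: SU_counit_rel => i j; apply: freealg_eval_gen.
Qed.

Definition SU_pres := ProperRel SU_proper.
Definition SUq3 := quotalg SU_pres.
HB.instance Definition _ := GRing.Algebra.on SUq3.

Definition ucoef (i j : 'I_3) : SUq3 := presgen SU_pres (i, j).

(* The involution of SUq3 and its two actions of Uq; each of the three maps   *)
(* is determined by these properties. As the coproduct and the antipode of Uq *)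
(* are (anti)multiplicative, the conditions that involve them are stated for  *)
(* the generators of Uq.                                                      *)
Record SUq3_structure := SUq3Structure {
  star : SUq3 -> SUq3;
  lact : Uq -> SUq3 -> SUq3;
  ract : SUq3 -> Uq -> SUq3;

  star_conjlinear : forall c a b, star (c *: a + b) = c^* *: star a + star b;
  starM : forall a b, star (a * b) = star b * star a;
  starK : involutive star;
  star_ucoef : forall i j : 'I_3,
    star (ucoef i j) = (- qC) ^ (j%:Z - i%:Z) *:
      (ucoef (lift i (0 : 'I_2)) (lift j (0 : 'I_2)) *
         ucoef (lift i (1 : 'I_2)) (lift j (1 : 'I_2))
       - qC *: (ucoef (lift i (0 : 'I_2)) (lift j (1 : 'I_2)) *
                  ucoef (lift i (1 : 'I_2)) (lift j (0 : 'I_2))));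

  lact_linearl : forall a c g h,
    lact (c *: g + h) a = c *: lact g a + lact h a;
  lact_linearr : forall h c a b,
    lact h (c *: a + b) = c *: lact h a + lact h b;
  lact1 : forall a, lact 1 a = a;
  lactM : forall g h a, lact (g * h) a = lact g (lact h a);
  lact_mul : forall g a b, lact (Ugen g) (a * b) =
    \sum_(p <- coproduct_gen g) lact p.1 a * lact p.2 b;
  lact_unit : forall h, lact h 1 = counit h *: 1;
  lact_star : forall g a,
    star (lact (Ugen g) a) = lact (star_antipode_gen g) (star a);
  lactK : forall i j k, lact (UK i) (ucoef j k) =
    q_half ^ ((k == hi i)%:Z - (k == lo i)%:Z) *: ucoef j k;
  lactE : forall i j k,
    lact (UE i) (ucoef j k) = (k == lo i)%:R *: ucoef j (hi i);
  lactF : forall i j k,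
    lact (UF i) (ucoef j k) = (k == hi i)%:R *: ucoef j (lo i);

  ract_linearl : forall h c a b,
    ract (c *: a + b) h = c *: ract a h + ract b h;
  ract_linearr : forall a c g h,
    ract a (c *: g + h) = c *: ract a g + ract a h;
  ract1 : forall a, ract a 1 = a;
  ractM : forall a g h, ract a (g * h) = ract (ract a g) h;
  ract_mul : forall g a b, ract (a * b) (Ugen g) =
    \sum_(p <- coproduct_gen g) ract a p.1 * ract b p.2;
  ract_unit : forall h, ract 1 h = counit h *: 1;
  ract_star : forall g a,
    star (ract a (Ugen g)) = ract (star a) (star_antipode_gen g);
  ractK : forall i j k, ract (ucoef j k) (UK i) =
    q_half ^ ((j == hi i)%:Z - (j == lo i)%:Z) *: ucoef j k;
  ractE : forall i j k,
    ract (ucoef j k) (UE i) = (j == hi i)%:R *: ucoef (lo i) k;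
  ractF : forall i j k,
    ract (ucoef j k) (UF i) = (j == lo i)%:R *: ucoef (hi i) k;

  lactC : forall h a k, ract (lact h a) k = lact h (ract a k) }.

(* The element K = (K_1 K_2)^{-4}.                                            *)
Definition UKmod : Uq := (UKinv 1 * UKinv 0) ^+ 4.

(* The subalgebra of Uq generated by K_1, K_1^{-1}, E_1, F_1.                 *)
Inductive in_Usu2 : Uq -> Prop :=
| Usu2_K : in_Usu2 (UK 0)
| Usu2_Kinv : in_Usu2 (UKinv 0)
| Usu2_E : in_Usu2 (UE 0)
| Usu2_F : in_Usu2 (UF 0)
| Usu2_1 : in_Usu2 1
| Usu2_lin c g h of in_Usu2 g & in_Usu2 h : in_Usu2 (c *: g + h)
| Usu2_mul g h of in_Usu2 g & in_Usu2 h : in_Usu2 (g * h).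

Section ProjectivePlane.
Variable S : SUq3_structure.

Local Notation "h ▷ a" := (lact S h a) (at level 40, left associativity).
Local Notation "a ◁ h" := (ract S a h) (at level 40, left associativity).

Lemma ractB a b h : (a - b) ◁ h = a ◁ h - b ◁ h.
Proof.
by rewrite -[a - b](addrC (- b)) -[- b]scaleN1r ract_linearl scaleN1r addrC.
Qed.
Lemma ract0 h : 0 ◁ h = 0.
Proof. by rewrite -[X in X ◁ _](subrr 0) ractB subrr. Qed.
Lemma ractD a b h : (a + b) ◁ h = a ◁ h + b ◁ h.
Proof. by rewrite -[X in (X + _) ◁ _]scale1r ract_linearl scale1r. Qed.
Lemma ractZ c a h : (c *: a) ◁ h = c *: (a ◁ h).
Proof. by rewrite -[c *: a]addr0 ract_linearl ract0 addr0. Qed.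
Lemma ractBr a g h : a ◁ (g - h) = a ◁ g - a ◁ h.
Proof.
by rewrite -[g - h](addrC (- h)) -[- h]scaleN1r ract_linearr scaleN1r addrC.
Qed.
Lemma ractr0 a : a ◁ 0 = 0.
Proof. by rewrite -[X in _ ◁ X](subrr 0) ractBr subrr. Qed.
Lemma ractDr a g h : a ◁ (g + h) = a ◁ g + a ◁ h.
Proof. by rewrite -[X in _ ◁ (X + _)]scale1r ract_linearr scale1r. Qed.
Lemma ractZr c a h : a ◁ (c *: h) = c *: (a ◁ h).
Proof. by rewrite -[c *: h]addr0 ract_linearr ractr0 addr0. Qed.

Lemma ractMK a b i : (a * b) ◁ UK i = (a ◁ UK i) * (b ◁ UK i).
Proof. by rewrite [LHS]ract_mul big_seq1. Qed.
Lemma ractMKinv a b i : (a * b) ◁ UKinv i = (a ◁ UKinv i) * (b ◁ UKinv i).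
Proof. by rewrite [LHS]ract_mul big_seq1. Qed.
Lemma ractME a b i :
  (a * b) ◁ UE i = (a ◁ UE i) * (b ◁ UK i) + (a ◁ UKinv i) * (b ◁ UE i).
Proof. by rewrite [LHS]ract_mul big_cons big_seq1. Qed.
Lemma ractMF a b i :
  (a * b) ◁ UF i = (a ◁ UF i) * (b ◁ UK i) + (a ◁ UKinv i) * (b ◁ UF i).
Proof. by rewrite [LHS]ract_mul big_cons big_seq1. Qed.

Definition in_S5 (a : SUq3) : Prop :=
  forall h, in_Usu2 h -> a ◁ h = counit h *: a.

Definition in_CP2 (a : SUq3) : Prop :=
  in_S5 a /\ a ◁ (UK 0 * UK 1 ^+ 2) = a.

Lemma in_S5P a :
  [/\ a ◁ UK 0 = a, a ◁ UKinv 0 = a, a ◁ UE 0 = 0 & a ◁ UF 0 = 0] <->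
  in_S5 a.
Proof.
split=> [[aK aKi aE aF] h|aS].
  elim=> {h} [|||||c g h _ ag _ ah|g h _ ag _ ah].
  - by rewrite counit_gen aK scale1r.
  - by rewrite counit_gen aKi scale1r.
  - by rewrite counit_gen aE scale0r.
  - by rewrite counit_gen aF scale0r.
  - by rewrite ract1 rmorph1 scale1r.
  - by rewrite ract_linearr ag ah linearP scalerDl scalerA.
  - by rewrite ractM ag ractZ ah rmorphM scalerA.
have aE g : in_Usu2 (Ugen g) -> a ◁ Ugen g = Uq_counit_gen g *: a.
  by move=> /aS ->; rewrite counit_gen.
split; rewrite aE ?(scale1r, scale0r) //; by constructor.
Qed.

Lemma ractMW a b : (a * b) ◁ (UK 0 * UK 1 ^+ 2) =
  (a ◁ (UK 0 * UK 1 ^+ 2)) * (b ◁ (UK 0 * UK 1 ^+ 2)).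
Proof. by rewrite !expr2 !ractM !ractMK. Qed.

Definition CP2_pred : {pred SUq3} := fun a => `[< in_CP2 a >].

Fact CP2_subalg_closed : subalg_closed CP2_pred.
Proof.
split.
- apply/asboolP; split=> [h _|]; first by rewrite ract_unit.
  rewrite ract_unit rmorphM rmorphXn /= !counit_gen /=.
  by rewrite expr1n mulr1 scale1r.
- move=> c a b /asboolP[aS aW] /asboolP[bS bW]; apply/asboolP.
  split=> [h hS|]; last by rewrite ract_linearl aW bW.
  by rewrite ract_linearl (aS h hS) (bS h hS) scalerDr !scalerA mulrC.
- move=> a b /asboolP[/in_S5P[aK aKi aE aF] aW].
  move=> /asboolP[/in_S5P[bK bKi bE bF] bW]; apply/asboolP.
  split; last by rewrite ractMW aW bW.
  apply/in_S5P; rewrite ractMK ractMKinv ractME ractMF aK aKi aE aF bK bKi bE bF.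
  by rewrite !mulr0 !mul0r !addr0.
Qed.

HB.instance Definition _ :=
  GRing.isSubalgClosed.Build C SUq3 CP2_pred CP2_subalg_closed.

Definition CP2 : Type := {a : SUq3 | CP2_pred a}.
HB.instance Definition _ := SubChoice.on CP2.
HB.instance Definition _ := [SubChoice_isSubAlgebra of CP2 by <:].

Lemma CP2P (a : CP2) : in_CP2 (val a).
Proof. by case: a => a /= /asboolP. Qed.

Lemma CP2_S5 (a : CP2) :
  [/\ val a ◁ UK 0 = val a, val a ◁ UKinv 0 = val a,
      val a ◁ UE 0 = 0 & val a ◁ UF 0 = 0].
Proof. by have [/in_S5P] := CP2P a. Qed.

Fact CP2_lact_subproof h (a : CP2) : CP2_pred (h ▷ val a).
Proof.
have [aS aW] := CP2P a; apply/asboolP.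
have lactZ c b : h ▷ (c *: b) = c *: (h ▷ b).
  have lact0 : h ▷ 0 = 0.
    have := lact_linearr S h (-1) 0 0.
    by rewrite scaler0 addr0 scaleN1r addNr.
  by have := lact_linearr S h c b 0; rewrite lact0 !addr0.
split=> [k kS|]; last by rewrite lactC aW.
by rewrite lactC (aS k kS) lactZ.
Qed.

Definition CP2_lact h (a : CP2) : CP2 := exist _ (h ▷ val a) (CP2_lact_subproof h a).

Definition sigma : CP2 -> CP2 := CP2_lact UKmod.

(* The pairs (v_+, v_-) on which K_1 K_2^2 acts by the scalar w.              *)
Definition is_form (w : C) (v : SUq3 * SUq3) : Prop :=
  [/\ v.1 ◁ UK 0 = q_half *: v.1 /\ v.2 ◁ UK 0 = q_half^-1 *: v.2,
      v.1 ◁ UF 0 = 0 /\ v.2 ◁ UF 0 = v.1,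
      v.1 ◁ UE 0 = v.2 /\ v.2 ◁ UE 0 = 0
    & v.1 ◁ (UK 0 * UK 1 ^+ 2) = w *: v.1 /\
      v.2 ◁ (UK 0 * UK 1 ^+ 2) = w *: v.2].

Definition form_pred w : {pred SUq3 * SUq3} := fun v => `[< is_form w v >].

Fact form_submod_closed w : submod_closed (form_pred w).
Proof.
split; first by apply/asboolP; split; rewrite /= !ract0 ?scaler0.
move=> c [v1 v2] [w1 w2] /asboolP[[/= vK1 vK2] [vF1 vF2] [vE1 vE2] [vW1 vW2]].
move=> /asboolP[[/= wK1 wK2] [wF1 wF2] [wE1 wE2] [wW1 wW2]].
apply/asboolP; split; rewrite /= !ract_linearl.
- by rewrite vK1 vK2 wK1 wK2 !scalerDr !scalerA ![c * _]mulrC.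
- by rewrite vF1 vF2 wF1 wF2 scaler0 addr0.
- by rewrite vE1 vE2 wE1 wE2 scaler0 addr0.
- by rewrite vW1 vW2 wW1 wW2 !scalerDr !scalerA ![c * _]mulrC.
Qed.

HB.instance Definition _ w :=
  GRing.isSubmodClosed.Build C (SUq3 * SUq3)%type (form_pred w)
    (form_submod_closed w).

Definition form w : Type := {v : SUq3 * SUq3 | form_pred w v}.
HB.instance Definition _ w := SubChoice.on (form w).
HB.instance Definition _ w := [SubChoice_isSubLmodule of form w by <:].

Lemma formP w (v : form w) : is_form w (val v).
Proof. by case: v => v /= /asboolP. Qed.

Fact form_lmul_subproof w (a : CP2) (v : form w) :
  form_pred w (val a * (val v).1, val a * (val v).2).
Proof.
have [aK aKi aE aF] := CP2_S5 a; have [_ aW] := CP2P a.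
have [[vK1 vK2] [vF1 vF2] [vE1 vE2] [vW1 vW2]] := formP v.
apply/asboolP; split=> /=.
- by rewrite !ractMK aK vK1 vK2 !scalerAr.
- by rewrite !ractMF aF aKi vF1 vF2 !mul0r mulr0 !add0r.
- by rewrite !ractME aE aKi vE1 vE2 !mul0r mulr0 !add0r.
- by rewrite !ractMW aW vW1 vW2 !scalerAr.
Qed.

Fact form_rmul_subproof w (v : form w) (a : CP2) :
  form_pred w ((val v).1 * val a, (val v).2 * val a).
Proof.
have [aK aKi aE aF] := CP2_S5 a; have [_ aW] := CP2P a.
have [[vK1 vK2] [vF1 vF2] [vE1 vE2] [vW1 vW2]] := formP v.
apply/asboolP; split=> /=.
- by rewrite !ractMK aK vK1 vK2 !scalerAl.
- by rewrite !ractMF aF aK vF1 vF2 !mulr0 mul0r !addr0.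
- by rewrite !ractME aE aK vE1 vE2 !mulr0 mul0r !addr0.
- by rewrite !ractMW aW vW1 vW2 !scalerAl.
Qed.

Definition form_lmul w (a : CP2) (v : form w) : form w :=
  exist _ (val a * (val v).1, val a * (val v).2) (form_lmul_subproof a v).
Definition form_rmul w (v : form w) (a : CP2) : form w :=
  exist _ ((val v).1 * val a, (val v).2 * val a) (form_rmul_subproof v a).

Definition Form10 := form (q_half ^- 3).
Definition Form01 := form (q_half ^+ 3).
Definition Form1 : Type := (Form10 * Form01)%type.
HB.instance Definition _ := GRing.Lmodule.on Form1.

Definition form1_lmul (a : CP2) (v : Form1) : Form1 :=
  (form_lmul a v.1, form_lmul a v.2).
Definition form1_rmul (v : Form1) (a : CP2) : Form1 :=
  (form_rmul v.1 a, form_rmul v.2 a).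

Section Calculus.
Hypothesis hq : 0 < q < 1.

Let qh_neq0 : q_half != 0.
Proof.
case/andP: hq => q_gt0 _.
by rewrite -[0]/(0%:C%C) (inj_eq (@complexI R)) sqrtr_eq0 -ltNge.
Qed.

Let qE : qC = q_half ^+ 2.
Proof.
case/andP: hq => q_gt0 _.
by rewrite -rmorphXn /= sqr_sqrtr // ltW.
Qed.

Let qqV_neq0 : qC - qC^-1 != 0.
Proof.
case/andP: hq => q_gt0 q_lt1.
have q_neq0 : q != 0 by rewrite gt_eqF.
rewrite -fmorphV -rmorphB /= -[0]/(0%:C%C) (inj_eq (@complexI R)).
rewrite subr_eq0 -(inj_eq (mulfI q_neq0)) mulfV // lt_eqF //.
by rewrite mulr_ilt1 // ltW.
Qed.

Let ord01 : (0 : 'I_2) != 1. Proof. by []. Qed.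
Let ord10 : (1 : 'I_2) != 0. Proof. by []. Qed.

Section Weights.
Variable (a : CP2).
Let aK : val a ◁ UK 0 = val a. Proof. by have [] := CP2_S5 a. Qed.
Let aE : val a ◁ UE 0 = 0. Proof. by have [] := CP2_S5 a. Qed.
Let aF : val a ◁ UF 0 = 0. Proof. by have [] := CP2_S5 a. Qed.
Let aW : val a ◁ (UK 0 * UK 1 ^+ 2) = val a. Proof. by have [] := CP2P a. Qed.

Let Kinv_eigen b c : c != 0 -> b ◁ UK 0 = c *: b -> b ◁ UKinv 0 = c^-1 *: b.
Proof.
move=> c_neq0 bK; apply: (scalerI c_neq0); rewrite scalerA divff // scale1r.
by rewrite -ractZ -bK -ractM (Uq_relP (UqKV _ _ _ _ 0)) ract1.
Qed.

Let E1K0 b : b ◁ UE 1 ◁ UK 0 = q_half *: (b ◁ UK 0 ◁ UE 1).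
Proof.
rewrite -!ractM (Uq_relP (UqKE' _ _ _ _ ord01)) ractZr scalerA divff //.
by rewrite scale1r.
Qed.
Let E0K1 b : b ◁ UE 0 ◁ UK 1 = q_half *: (b ◁ UK 1 ◁ UE 0).
Proof.
rewrite -!ractM (Uq_relP (UqKE' _ _ _ _ ord10)) ractZr scalerA divff //.
by rewrite scale1r.
Qed.
Let EK i b : b ◁ UE i ◁ UK i = q_half ^- 2 *: (b ◁ UK i ◁ UE i).
Proof.
rewrite -!ractM (Uq_relP (UqKE _ _ _ _ i)) ractZr scalerA qE mulVf ?scale1r //.
by rewrite expf_neq0.
Qed.
Let F1K0 b : b ◁ UF 1 ◁ UK 0 = q_half^-1 *: (b ◁ UK 0 ◁ UF 1).
Proof. by rewrite -!ractM (Uq_relP (UqKF' _ _ _ _ ord01)) ractZr. Qed.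
Let F0K1 b : b ◁ UF 0 ◁ UK 1 = q_half^-1 *: (b ◁ UK 1 ◁ UF 0).
Proof. by rewrite -!ractM (Uq_relP (UqKF' _ _ _ _ ord10)) ractZr. Qed.
Let FK i b : b ◁ UF i ◁ UK i = q_half ^+ 2 *: (b ◁ UK i ◁ UF i).
Proof. by rewrite -!ractM (Uq_relP (UqKF _ _ _ _ i)) ractZr qE. Qed.

Let EFC b i j : i != j -> b ◁ UE i ◁ UF j = b ◁ UF j ◁ UE i.
Proof.
move=> ij; apply/eqP; rewrite -subr_eq0 -!ractM -ractBr.
by rewrite (Uq_relP (UqEF' _ _ _ _ ij)) ractr0.
Qed.

Let EF0 b c : c != 0 -> b ◁ UK 0 = c *: b ->
  b ◁ UE 0 ◁ UF 0 - b ◁ UF 0 ◁ UE 0 =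
    ((qC - qC^-1)^-1 * (c ^+ 2 - c ^- 2)) *: b.
Proof.
move=> c_neq0 bK; have bKi := Kinv_eigen c_neq0 bK.
rewrite -!ractM -ractBr (Uq_relP (UqEF _ _ _ _ 0)) ractZr ractBr !expr2 !ractM.
by rewrite !(bK, bKi, ractZ) !scalerA -scalerBl scalerA invfM.
Qed.

Fact partial_subproof (c : C) :
  form_pred (q_half ^- 3) (c *: (val a ◁ UE 1), c *: (val a ◁ (UE 1 * UE 0))).
Proof.
have: (val a ◁ UE 1, val a ◁ (UE 1 * UE 0)) \in form_pred (q_half ^- 3);
  last by move=> /(rpredZ c).
have v1K : val a ◁ UE 1 ◁ UK 0 = q_half *: (val a ◁ UE 1) by rewrite E1K0 aK.
have v1F : val a ◁ UE 1 ◁ UF 0 = 0 by rewrite EFC // aF ract0.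
have qh2 : q_half ^+ 2 != 0 by rewrite expf_neq0.
apply/asboolP; split; rewrite /= !(ractM S _ (UE 1) (UE 0)).
- by rewrite v1K EK v1K ractZ scalerA exprS invfM -mulrA mulVf ?mulr1.
- split=> //; have := EF0 qh_neq0 v1K.
  by rewrite v1F ract0 subr0 -qE mulVf // scale1r.
- split=> //; rewrite -!ractM.
  have := Uq_relP (UqSerreE UK UKinv UE UF ord01) => /(congr1 (ract S (val a))).
  rewrite ractDr ractZr expr2 !ractM aE !ract0 scaler0 add0r => <-.
  by rewrite -!ractM mulrA.
have E1W b : b ◁ UE 1 ◁ (UK 0 * UK 1 ^+ 2) =
    q_half ^- 3 *: (b ◁ (UK 0 * UK 1 ^+ 2) ◁ UE 1).
  rewrite expr2 !ractM E1K0 !ractZ EK ractZ EK !scalerA; congr (_ *: _).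
  by rewrite -!exprVn [in RHS]exprS -mulrA -exprD (exprS _ 3) mulrA divff // mul1r.
have E0W b : b ◁ UE 0 ◁ (UK 0 * UK 1 ^+ 2) = b ◁ (UK 0 * UK 1 ^+ 2) ◁ UE 0.
  rewrite expr2 !ractM EK !ractZ E0K1 ractZ E0K1 !scalerA.
  by rewrite -mulrA -expr2 mulVf // scale1r.
by rewrite E0W !E1W !aW ractZ.
Qed.

Fact partialbar_subproof (c : C) :
  form_pred (q_half ^+ 3) (c *: (val a ◁ (UF 1 * UF 0)), c *: (val a ◁ UF 1)).
Proof.
have: (val a ◁ (UF 1 * UF 0), val a ◁ UF 1) \in form_pred (q_half ^+ 3);
  last by move=> /(rpredZ c).
have v2K : val a ◁ UF 1 ◁ UK 0 = q_half^-1 *: (val a ◁ UF 1) by rewrite F1K0 aK.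
have v2E : val a ◁ UF 1 ◁ UE 0 = 0 by rewrite -EFC // aE ract0.
have qh2 : q_half ^+ 2 != 0 by rewrite expf_neq0.
apply/asboolP; split; rewrite /= !(ractM S _ (UF 1) (UF 0)).
- by rewrite v2K FK v2K ractZ scalerA expr2 -mulrA divff ?mulr1.
- split=> //; rewrite -!ractM.
  have := Uq_relP (UqSerreF UK UKinv UE UF ord01) => /(congr1 (ract S (val a))).
  rewrite ractDr ractZr expr2 !ractM aF !ract0 scaler0 addr0 => <-.
  by rewrite -!ractM mulrA.
- split=> //; have := EF0 (invr_neq0 qh_neq0) v2K.
  rewrite v2E ract0 sub0r => /(congr1 -%R); rewrite opprK => ->.
  by rewrite exprVn invrK -qE -[qC^-1 - qC]opprB mulrN mulVf // scaleN1r opprK.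
have F1W b : b ◁ UF 1 ◁ (UK 0 * UK 1 ^+ 2) =
    q_half ^+ 3 *: (b ◁ (UK 0 * UK 1 ^+ 2) ◁ UF 1).
  rewrite expr2 !ractM F1K0 !ractZ FK ractZ FK !scalerA; congr (_ *: _).
  by rewrite -mulrA -exprD (exprS _ 3) mulrA mulVf // mul1r.
have F0W b : b ◁ UF 0 ◁ (UK 0 * UK 1 ^+ 2) = b ◁ (UK 0 * UK 1 ^+ 2) ◁ UF 0.
  rewrite expr2 !ractM FK !ractZ F0K1 ractZ F0K1 !scalerA.
  by rewrite -mulrA -expr2 exprVn divff // scale1r.
by rewrite F0W !F1W !aW ractZ.
Qed.

End Weights.

(* The constants c and c' are the unspecified multiplicative constants in the *)
(* definitions of the two differentials.                                      *)
Variables c c' : C.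

Definition partial (a : CP2) : Form10 :=
  exist _ (c *: (val a ◁ UE 1), c *: (val a ◁ (UE 1 * UE 0)))
    (partial_subproof a c).
Definition partialbar (a : CP2) : Form01 :=
  exist _ (c' *: (val a ◁ (UF 1 * UF 0)), c' *: (val a ◁ UF 1))
    (partialbar_subproof a c').
Definition extd (a : CP2) : Form1 := (partial a, partialbar a).

(* The tensor algebra of the bimodule Form1 over CP2 is the algebra generated *)
(* by CP2 and Form1 subject to the relations of the algebra CP2, to the       *)
(* linearity of Form1 and to the bimodule relations; Omega_prolong adds the   *)
(* relations of the maximal prolongation.                                     *)
Section OmegaRelation.
Variables (B : algType C) (iota : CP2 -> B) (form1 : Form1 -> B).

Inductive Omega_relation : B -> B -> Prop :=
| Omega_fun_linear k a b :
    Omega_relation (iota (k *: a + b)) (k *: iota a + iota b)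
| Omega_fun1 : Omega_relation (iota 1) 1
| Omega_funM a b : Omega_relation (iota (a * b)) (iota a * iota b)
| Omega_form_linear k v w :
    Omega_relation (form1 (k *: v + w)) (k *: form1 v + form1 w)
| Omega_lmul a v : Omega_relation (form1 (form1_lmul a v)) (iota a * form1 v)
| Omega_rmul v a : Omega_relation (form1 (form1_rmul v a)) (form1 v * iota a)
| Omega_prolong (s : seq (CP2 * CP2))
    of \sum_(p <- s) form1_lmul p.1 (extd p.2) = 0 :
    Omega_relation (\sum_(p <- s) form1 (extd p.1) * form1 (extd p.2)) 0.

End OmegaRelation.

Definition Omega_free_relation :=
  @Omega_relation (freealg C (CP2 + Form1)%type)
    (fun a => fgen C (inl a)) (fun v => fgen C (inr v)).

Lemma Omega_relation_degree0 (B : algType C) (f : {lrmorphism B -> SUq3})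
    (iota : CP2 -> B) (form1 : Form1 -> B) :
    (forall a, f (iota a) = val a) -> (forall v, f (form1 v) = 0) ->
  forall x y, Omega_relation iota form1 x y -> f x = f y.
Proof.
move=> fi ff x y.
case=> [k a b||a b|k v w|a v|v a|s _].
- by rewrite [RHS]linearP /= !fi.
- by rewrite fi [RHS]rmorph1.
- by rewrite [RHS]rmorphM /= !fi.
- by rewrite [RHS]linearP /= !ff scaler0 addr0.
- by rewrite [RHS]rmorphM /= !ff mulr0.
- by rewrite [RHS]rmorphM /= !ff mul0r.
by rewrite rmorph0 rmorph_sum big1 // => p _; rewrite rmorphM /= ff mul0r.
Qed.

Fact Omega_proper : ~ rel_ideal Omega_free_relation 1.
Proof.
pose g (x : CP2 + Form1) : SUq3 := if x is inl a then val a else 0.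
apply: (@proper_ker _ _ _ _ (freealg_eval g)).
by apply: Omega_relation_degree0 => ?; apply: freealg_eval_gen.
Qed.

Definition Omega_pres := ProperRel Omega_proper.
Definition Omega := quotalg Omega_pres.
HB.instance Definition _ := GRing.Algebra.on Omega.

Definition iota (a : CP2) : Omega := presgen Omega_pres (inl a).
Definition form1 (v : Form1) : Omega := presgen Omega_pres (inr v).

Definition del (a : CP2) : Omega := form1 (partial a, 0).
Definition delbar (a : CP2) : Omega := form1 (0, partialbar a).
Definition d (a : CP2) : Omega := form1 (extd a).

(* Omega^{(m,n)}, spanned by the products of m elements of Omega^{(1,0)} and  *)
(* n elements of Omega^{(0,1)} in any order.                                  *)
Inductive in_Omega : nat -> nat -> Omega -> Prop :=
| in_Omega00 a : in_Omega 0 0 (iota a)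
| in_Omega10 m n v x of in_Omega m n x : in_Omega m.+1 n (form1 (v, 0) * x)
| in_Omega01 m n v x of in_Omega m n x : in_Omega m n.+1 (form1 (0, v) * x)
| in_OmegaD m n x y of in_Omega m n x & in_Omega m n y : in_Omega m n (x + y).

(* Omega is the direct sum of the Omega^{(m,n)} with 0 <= m, n <= 2.          *)
Definition Omega_bigraded : Prop :=
  (forall m n x, in_Omega m n x -> ~~ ((m <= 2) && (n <= 2))%N -> x = 0) /\
  (forall f : 'I_3 -> 'I_3 -> Omega,
     (forall m n : 'I_3, in_Omega m n (f m n)) ->
     \sum_m \sum_n f m n = 0 -> forall m n, f m n = 0).

(* The extensions to Omega of the two differentials on functions.             *)
Record is_dolbeault (D Db : Omega -> Omega) : Prop := IsDolbeault {
  dolb_linear : forall k x y, D (k *: x + y) = k *: D x + D y;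
  dolb_fun : forall a, D (iota a) = del a;
  dolb_bidegree : forall m n x, in_Omega m n x -> in_Omega m.+1 n (D x);
  dolb_leibniz : forall m n x y, in_Omega m n x ->
    D (x * y) = D x * y + (-1) ^+ (m + n) * (x * D y);
  dolbbar_linear : forall k x y, Db (k *: x + y) = k *: Db x + Db y;
  dolbbar_fun : forall a, Db (iota a) = delbar a;
  dolbbar_bidegree : forall m n x, in_Omega m n x -> in_Omega m n.+1 (Db x);
  dolbbar_leibniz : forall m n x y, in_Omega m n x ->
    Db (x * y) = Db x * y + (-1) ^+ (m + n) * (x * Db y);
  dolb_sqr : forall x, D (D x) = 0;
  dolbbar_sqr : forall x, Db (Db x) = 0;
  dolb_anticomm : forall x, D (Db x) + Db (D x) = 0 }.

(* The extension to Omega of the left action of Uq.                           *)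
Record is_Omega_action (D Db : Omega -> Omega) (act : Uq -> Omega -> Omega) :
    Prop := IsOmegaAction {
  act_linearl : forall x k g h, act (k *: g + h) x = k *: act g x + act h x;
  act_linearr : forall h k x y, act h (k *: x + y) = k *: act h x + act h y;
  act1 : forall x, act 1 x = x;
  actM : forall g h x, act (g * h) x = act g (act h x);
  act_fun : forall h a, act h (iota a) = iota (CP2_lact h a);
  act_mul : forall g x y, act (Ugen g) (x * y) =
    \sum_(p <- coproduct_gen g) act p.1 x * act p.2 y;
  act_dolb : forall h x, act h (D x) = D (act h x);
  act_dolbbar : forall h x, act h (Db x) = Db (act h x) }.

Record is_volume_form (act : Uq -> Omega -> Omega) (omega : Omega) : Prop :=
    IsVolumeForm {
  vol_bidegree : in_Omega 2 2 omega;
  vol_basis : forall x, in_Omega 2 2 x -> exists! a, x = iota a * omega;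
  vol_central : forall a, omega * iota a = iota a * omega;
  vol_invariant : forall h, act h omega = counit h *: omega }.

(* The functional a omega |-> h a.                                            *)
Definition integral (h : SUq3 -> C) (omega x : Omega) : C :=
  h (val (xget 0 [set a : CP2 | x = iota a * omega]%classic)).

Section Cocycles.
Variables (h : SUq3 -> C) (omega : Omega).

Definition tau : cochain CP2 4 := fun a =>
  - integral h omega
      (iota (a (inord 0)) * d (a (inord 1)) * d (a (inord 2))
         * d (a (inord 3)) * d (a (inord 4))).

Definition phi1 : cochain CP2 4 := fun a =>
  - 3%:R * integral h omega
      (iota (a (inord 0)) * del (a (inord 1)) * del (a (inord 2))
         * delbar (a (inord 3)) * delbar (a (inord 4))).

Definition phi2 : cochain CP2 4 := fun a =>
  - 3%:R * integral h omega
      (iota (a (inord 0)) * delbar (a (inord 1)) * delbar (a (inord 2))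
         * del (a (inord 3)) * del (a (inord 4))).

Definition phi : cochain CP2 4 := fun a => phi1 a + phi2 a.

End Cocycles.

End Calculus.

(* The Haar state. For the invariance, Delta is multiplicative and            *)
(* Delta (u^i_j) = \sum_k u^i_k (x) u^k_j, so on monomials                    *)
(* Delta (\prod_t u^{i_t}_{j_t}) =                                            *)
(*   \sum_k (\prod_t u^{i_t}_{k_t}) (x) (\prod_t u^{k_t}_{j_t}).              *)
Record is_haar_state (h : SUq3 -> C) : Prop := IsHaarState {
  haar_linear : forall k x y, h (k *: x + y) = k * h x + h y;
  haar1 : h 1 = 1;
  haar_ge0 : forall x, 0 <= h (star S x * x);
  haar_invl : forall n (i j : 'I_n -> 'I_3),
    \sum_(k : {ffun 'I_n -> 'I_3})
       h (\prod_(t < n) ucoef (k t) (j t)) *: \prod_(t < n) ucoef (i t) (k t) =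
    h (\prod_(t < n) ucoef (i t) (j t)) *: 1;
  haar_invr : forall n (i j : 'I_n -> 'I_3),
    \sum_(k : {ffun 'I_n -> 'I_3})
       h (\prod_(t < n) ucoef (i t) (k t)) *: \prod_(t < n) ucoef (k t) (j t) =
    h (\prod_(t < n) ucoef (i t) (j t)) *: 1 }.

(* The modular automorphism of the Haar state; it extends sigma.              *)
Definition sigmaSU (x : SUq3) : SUq3 := UKmod ▷ x ◁ UKmod.

End ProjectivePlane.

End QuantumSU3.

(* Main.v *)
Require Import Defs.
From mathcomp Require Import all_boot all_order all_algebra.
From mathcomp Require Import boolp classical_sets reals complex ring zify.

(** By the graded Leibniz rule, the second-order operator [g a = D (delbar a)]
    satisfies [g (ab) - g a b - a g b = del a delbar b - delbar a del b].  For a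
    3-cochain [int a0 X1(a1) X2(a2) X3(a3)] whose letters are derivations except
    for one letter [g], the twisted trace property of the integral makes the
    twisted coboundary telescope to the contribution of the defect of [g], that
    is, to the difference of two 4-cochains whose words in [del], [delbar]
    differ by the exchange of two adjacent letters.  Hence the six words with
    two letters of each kind are all cohomologous.  As [d = del + delbar], the
    cochain [tau] is minus the sum of these six words (the others vanish for
    degree reasons), while [phi] is -3 times the sum of two of them. *)

Set Implicit Arguments.
Unset Strict Implicit.
Unset Printing Implicit Defensive.

Import Order.TTheory GRing.Theory Num.Theory.
Local Open Scope ring_scope.

(** * Twisted cyclic rotations and twisted coboundaries *)

Section TwistedCochains.
Variables (K : comNzRingType) (A : algType K) (sigma : A -> A).

(** Each rotation brings the last argument to the front and twists it by [sigma]; as long as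
    [k <= n.+1], no argument is twisted more than once. *)
Lemma iter_lambda_sigma n (phi : cochain A n) k (a : 'I_n.+1 -> A) :
    (k <= n.+1)%N ->
  iter k (lambda_sigma sigma (n:=n)) phi a = (-1) ^+ (n * k) *
    phi (fun j => if (j < k)%N then sigma (a (inord (n.+1 - k + j)))
                  else a (inord (j - k))).
Proof.
elim: k a => [|k IHk] a lekn.
  rewrite muln0 expr0 mul1r; congr phi; apply/funext => j /=.
  by rewrite subn0 inord_val.
rewrite iterS /lambda_sigma IHk 1?ltnW // mulrA -exprD mulnS.
congr (_ * phi _); apply/funext => j.
have ltj := ltn_ord j.
(* The outermost rotation acts first on the arguments. Hence position [k] receives the newly twisted
   last argument, and every other position only sees an index shift. *)
have [ltjk|lekj] := ltnP j k.
  rewrite (leq_trans ltjk) // -val_eqE /= inordK; last by lia.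
  case: ifP => [/eqP|_]; first by lia.
  by congr (sigma (a (inord _))); lia.
rewrite -val_eqE /= inordK; last by lia.
case: ifP => [/eqP jk0|jk].
  rewrite ifT; last by lia.
  by congr (sigma (a _)); apply/val_inj; rewrite /= inordK; lia.
rewrite ifF; last by lia.
by congr (a (inord _)); lia.
Qed.

(** After a full turn every argument is back in place and twisted exactly once, with the sign
    (-1)^(n(n+1)) = 1. Invariance under [sigma] therefore suffices. *)
Lemma twisted_cochainI n (phi : cochain A n) :
  multilinear phi -> (forall a, phi (sigma \o a) = phi a) ->
  twisted_cochain sigma phi.
Proof.
move=> lphi phi_sigma; split=> // a; rewrite iter_lambda_sigma //.
rewrite -signr_odd oddM /= andbN mul1r; apply/eqP; rewrite subr_eq0; apply/eqP.
rewrite -[LHS]phi_sigma; congr phi; apply/funext => j /=.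
by rewrite ltn_ord subnn add0n inord_val.
Qed.

(** The coboundary of a curried cochain, with all indices in the form [inord i] used by the words,
    so that the telescoping becomes a [ring] identity. *)
Lemma b_sigmaE3 (g : A -> A -> A -> A -> K) (a : 'I_5 -> A) :
  b_sigma sigma (fun a : 'I_4 -> A =>
      g (a (inord 0)) (a (inord 1)) (a (inord 2)) (a (inord 3))) a =
  g (a (inord 0) * a (inord 1)) (a (inord 2)) (a (inord 3)) (a (inord 4))
  - g (a (inord 0)) (a (inord 1) * a (inord 2)) (a (inord 3)) (a (inord 4))
  + g (a (inord 0)) (a (inord 1)) (a (inord 2) * a (inord 3)) (a (inord 4))
  - g (a (inord 0)) (a (inord 1)) (a (inord 2)) (a (inord 3) * a (inord 4))
  + g (sigma (a (inord 4)) * a (inord 0))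
      (a (inord 1)) (a (inord 2)) (a (inord 3)).
Proof.
rewrite /b_sigma !big_ord_recl big_ord0 /= -!val_eqE /= !inordK //=.
have -> : ord_max = inord 4 :> 'I_5 by apply/val_inj; rewrite /= inordK.
have -> : ord0 = inord 0 :> 'I_5 by apply/val_inj; rewrite /= inordK.
rewrite /bump /=; ring.
Qed.

Lemma b_sigmaE4 (g : A -> A -> A -> A -> A -> K) (a : 'I_6 -> A) :
  b_sigma sigma (fun a : 'I_5 -> A =>
      g (a (inord 0)) (a (inord 1)) (a (inord 2)) (a (inord 3)) (a (inord 4)))
    a =
  g (a (inord 0) * a (inord 1))
    (a (inord 2)) (a (inord 3)) (a (inord 4)) (a (inord 5))
  - g (a (inord 0)) (a (inord 1) * a (inord 2))
      (a (inord 3)) (a (inord 4)) (a (inord 5))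
  + g (a (inord 0)) (a (inord 1)) (a (inord 2) * a (inord 3))
      (a (inord 4)) (a (inord 5))
  - g (a (inord 0)) (a (inord 1)) (a (inord 2)) (a (inord 3) * a (inord 4))
      (a (inord 5))
  + g (a (inord 0)) (a (inord 1)) (a (inord 2)) (a (inord 3))
      (a (inord 4) * a (inord 5))
  - g (sigma (a (inord 5)) * a (inord 0))
      (a (inord 1)) (a (inord 2)) (a (inord 3)) (a (inord 4)).
Proof.
rewrite /b_sigma !big_ord_recl big_ord0 /= -!val_eqE /= !inordK //=.
have -> : ord_max = inord 5 :> 'I_6 by apply/val_inj; rewrite /= inordK.
have -> : ord0 = inord 0 :> 'I_6 by apply/val_inj; rewrite /= inordK.
rewrite /bump /=; ring.
Qed.

Lemma twisted_cochain_lin n k (phi psi : cochain A n) :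
  twisted_cochain sigma phi -> twisted_cochain sigma psi ->
  twisted_cochain sigma (fun a => k * phi a + psi a).
Proof.
move=> [lphi tphi] [lpsi tpsi]; split=> [i a c x y|a].
  by rewrite lphi lpsi; ring.
move: (tphi a) (tpsi a); rewrite !iter_lambda_sigma // => phia psia.
by rewrite mulrDr opprD addrACA psia addr0 mulrCA -mulrBr phia mulr0.
Qed.

Lemma b_sigma_lin n k (phi psi : cochain A n) a :
  b_sigma sigma (fun a => k * phi a + psi a) a =
  k * b_sigma sigma phi a + b_sigma sigma psi a.
Proof.
rewrite /b_sigma [k * (_ + _)]mulrDr mulr_sumr addrACA -big_split /=.
congr (_ + _).
  by apply: eq_bigr => i _; ring.
ring.
Qed.

Lemma twisted_cochain0 n :
  twisted_cochain sigma (fun _ : 'I_n.+1 -> A => 0 : K).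
Proof. by apply: twisted_cochainI => // i a c x y; rewrite mulr0 addr0. Qed.

Lemma b_sigma0 n a : b_sigma sigma (fun _ : 'I_n.+1 -> A => 0 : K) a = 0.
Proof. by rewrite /b_sigma mulr0 addr0 big1 // => i _; rewrite mulr0. Qed.

End TwistedCochains.

(** * Words of operators in a bigraded algebra with a twisted trace *)

Section Words.
Variables (K : comNzRingType) (A W : algType K) (sigma : A -> A).
Variables (iota : A -> W) (deg : nat -> nat -> W -> Prop).
Variables (theta : W -> W) (int : W -> K).

Hypothesis iotaL : forall k a b, iota (k *: a + b) = k *: iota a + iota b.
Hypothesis iotaM : forall a b, iota (a * b) = iota a * iota b.
Hypothesis iota_deg : forall a, deg 0 0 (iota a).
Hypothesis degM : forall m n m' n' x y,
  deg m n x -> deg m' n' y -> deg (m + m') (n + n') (x * y).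
Hypothesis deg_lin : forall m n k x y,
  deg m n x -> deg m n y -> deg m n (k *: x + y).
Hypothesis thetaM : forall x y, theta (x * y) = theta x * theta y.
Hypothesis theta_iota : forall a, theta (iota a) = iota (sigma a).
Hypothesis intL : forall k x y, deg 2%N 2%N x -> deg 2%N 2%N y ->
  int (k *: x + y) = k * int x + int y.
Hypothesis int_trace : forall x a, deg 2%N 2%N x ->
  int (x * iota a) = int (iota (sigma a) * x).
Hypothesis int_theta : forall x, deg 2%N 2%N x -> int (theta x) = int x.

Let degL m n a x : deg m n x -> deg m n (iota a * x).
Proof. exact: degM (iota_deg a). Qed.
Let degR m n a x : deg m n x -> deg m n (x * iota a).
Proof. by move=> /degM /(_ (iota_deg a)); rewrite !addn0. Qed.

Let intD x y : deg 2%N 2%N x -> deg 2%N 2%N y -> int (x + y) = int x + int y.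
Proof. by move=> dx dy; have := intL 1 dx dy; rewrite scale1r mul1r. Qed.

Let intB x y : deg 2%N 2%N x -> deg 2%N 2%N y -> int (x - y) = int x - int y.
Proof. by move=> dx dy; rewrite addrC -scaleN1r intL // mulN1r addrC. Qed.

Definition word3 (X1 X2 X3 : A -> W) : cochain A 3 := fun a =>
  int (iota (a (inord 0)) * X1 (a (inord 1)) * X2 (a (inord 2))
         * X3 (a (inord 3))).

Definition word4 (X1 X2 X3 X4 : A -> W) : cochain A 4 := fun a =>
  int (iota (a (inord 0)) * X1 (a (inord 1)) * X2 (a (inord 2))
         * X3 (a (inord 3)) * X4 (a (inord 4))).

(** The requirements on one letter of a word: linearity and bidegree make the word multilinear and
    integrable, and commutation with [theta] makes it [sigma]-invariant. The Leibniz rule is kept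
    separate because a second-order letter must also be allowed. *)
Record equivariant (m n : nat) (X : A -> W) : Prop := Equivariant {
  equiv_linear : forall k a b, X (k *: a + b) = k *: X a + X b;
  equiv_deg : forall a, deg m n (X a);
  equiv_theta : forall a, theta (X a) = X (sigma a) }.

Definition derivation (X : A -> W) : Prop :=
  forall a b, X (a * b) = X a * iota b + iota a * X b.

Lemma word3_twisted_cochain m1 n1 m2 n2 m3 n3 X1 X2 X3 :
    equivariant m1 n1 X1 -> equivariant m2 n2 X2 -> equivariant m3 n3 X3 ->
    (m1 + m2 + m3)%N = 2%N -> (n1 + n2 + n3)%N = 2%N ->
  twisted_cochain sigma (word3 X1 X2 X3).
Proof.
move=> [L1 d1 e1] [L2 d2 e2] [L3 d3 e3] m2E n2E.
have deg22 a0 a1 a2 a3 : deg 2%N 2%N (iota a0 * X1 a1 * X2 a2 * X3 a3).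
  rewrite -[X in deg X _]m2E -[X in deg _ X]n2E.
  by do !apply: degM; do ?apply: degL.
apply: twisted_cochainI => [i a c x y|a]; last first.
  by rewrite /word3 /= -theta_iota -e1 -e2 -e3 -!thetaM int_theta.
rewrite /word3 /= -!val_eqE /= !inordK //.
case: i => -[|[|[|[|//]]]] ? /=; rewrite ?(iotaL, L1, L2, L3);
  by rewrite !(mulrDl, mulrDr, =^~ scalerAl, =^~ scalerAr) intL.
Qed.

Lemma word4_twisted_cochain m1 n1 m2 n2 m3 n3 m4 n4 X1 X2 X3 X4 :
    equivariant m1 n1 X1 -> equivariant m2 n2 X2 ->
    equivariant m3 n3 X3 -> equivariant m4 n4 X4 ->
    (m1 + m2 + m3 + m4)%N = 2%N -> (n1 + n2 + n3 + n4)%N = 2%N ->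
  twisted_cochain sigma (word4 X1 X2 X3 X4).
Proof.
move=> [L1 d1 e1] [L2 d2 e2] [L3 d3 e3] [L4 d4 e4] m2E n2E.
have deg22 a0 a1 a2 a3 a4 :
    deg 2%N 2%N (iota a0 * X1 a1 * X2 a2 * X3 a3 * X4 a4).
  rewrite -[X in deg X _]m2E -[X in deg _ X]n2E.
  by do !apply: degM; do ?apply: degL.
apply: twisted_cochainI => [i a c x y|a]; last first.
  by rewrite /word4 /= -theta_iota -e1 -e2 -e3 -e4 -!thetaM int_theta.
rewrite /word4 /= -!val_eqE /= !inordK //.
case: i => -[|[|[|[|[|//]]]]] ? /=; rewrite ?(iotaL, L1, L2, L3, L4);
  by rewrite !(mulrDl, mulrDr, =^~ scalerAl, =^~ scalerAr) intL.
Qed.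

(** The Leibniz rule splits each inner term of the coboundary in two, and neighbouring halves
    cancel. The one left over has [a (inord 5)] on the far right; the twisted trace cancels it
    against the last term. *)
Lemma b_word4 m1 n1 m2 n2 m3 n3 m4 n4 X1 X2 X3 X4 a :
    equivariant m1 n1 X1 -> equivariant m2 n2 X2 ->
    equivariant m3 n3 X3 -> equivariant m4 n4 X4 ->
    (m1 + m2 + m3 + m4)%N = 2%N -> (n1 + n2 + n3 + n4)%N = 2%N ->
    derivation X1 -> derivation X2 -> derivation X3 -> derivation X4 ->
  b_sigma sigma (word4 X1 X2 X3 X4) a = 0.
Proof.
move=> [_ d1 _] [_ d2 _] [_ d3 _] [_ d4 _] m2E n2E D1 D2 D3 D4.
(* Degrees are kept as literal sums over the letters, so that [degM] applies without arithmetic. *)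
have deg22 x : deg (m1 + m2 + m3 + m4) (n1 + n2 + n3 + n4) x -> deg 2%N 2%N x.
  by rewrite m2E n2E.
rewrite [LHS](b_sigmaE4 sigma (fun a0 a1 a2 a3 a4 =>
  int (iota a0 * X1 a1 * X2 a2 * X3 a3 * X4 a4))).
rewrite !(D1, D2, D3, D4, mulrDl, mulrDr, mulrA) -!iotaM.
have := int_trace (a (inord 5)) (deg22 (iota (a (inord 0)) * X1 (a (inord 1))
  * X2 (a (inord 2)) * X3 (a (inord 3)) * X4 (a (inord 4))) _).
rewrite !mulrA -iotaM => <-; last by do !apply: degM; do ?apply: degL.
rewrite !intD; do ?by [apply: deg22; do ?[exact: d1|exact: d2|exact: d3
   |exact: d4|apply: degL|apply: degR|apply: degM]].
ring.
Qed.

Definition leibniz_defect (X : A -> W) a b :=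
  X (a * b) - X a * iota b - iota a * X b.

(** The telescoping of [b_word4] for letters that need not be derivations: what survives is the
    Leibniz defect of each letter, with alternating signs. *)
Lemma b_word3 m1 n1 m2 n2 m3 n3 X1 X2 X3 a :
    equivariant m1 n1 X1 -> equivariant m2 n2 X2 -> equivariant m3 n3 X3 ->
    (m1 + m2 + m3)%N = 2%N -> (n1 + n2 + n3)%N = 2%N ->
  b_sigma sigma (word3 X1 X2 X3) a =
  - int (iota (a (inord 0)) * leibniz_defect X1 (a (inord 1)) (a (inord 2))
           * X2 (a (inord 3)) * X3 (a (inord 4)))
  + int (iota (a (inord 0)) * X1 (a (inord 1))
           * leibniz_defect X2 (a (inord 2)) (a (inord 3)) * X3 (a (inord 4)))
  - int (iota (a (inord 0)) * X1 (a (inord 1)) * X2 (a (inord 2))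
           * leibniz_defect X3 (a (inord 3)) (a (inord 4))).
Proof.
move=> [_ d1 _] [_ d2 _] [_ d3 _] m2E n2E.
have deg22 x : deg (m1 + m2 + m3) (n1 + n2 + n3) x -> deg 2%N 2%N x.
  by rewrite m2E n2E.
have degB m n x y : deg m n x -> deg m n y -> deg m n (x - y).
  by move=> dx dy; rewrite addrC -scaleN1r; apply: deg_lin.
rewrite [LHS](b_sigmaE3 sigma (fun a0 a1 a2 a3 =>
  int (iota a0 * X1 a1 * X2 a2 * X3 a3))).
rewrite /leibniz_defect !(mulrBl, mulrBr, mulrA) -!iotaM.
have := int_trace (a (inord 4)) (deg22 (iota (a (inord 0)) * X1 (a (inord 1))
  * X2 (a (inord 2)) * X3 (a (inord 3))) _).
rewrite !mulrA -iotaM => <-; last by do !apply: degM; do ?apply: degL.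
rewrite !intB; do ?by [apply: deg22; do ?[exact: d1|exact: d2|exact: d3
   |apply: (degB)|apply: degL|apply: degR|apply: degM]].
ring.
Qed.

(** * The six words with two letters [del] and two letters [delbar] *)

Variables (del delbar deldelbar d : A -> W).
Hypothesis del_equiv : equivariant 1%N 0%N del.
Hypothesis delbar_equiv : equivariant 0%N 1%N delbar.
Hypothesis deldelbar_equiv : equivariant 1%N 1%N deldelbar.
Hypothesis delM : derivation del.
Hypothesis delbarM : derivation delbar.
Hypothesis deldelbar_defect : forall a b,
  leibniz_defect deldelbar a b = del a * delbar b - delbar a * del b.
Hypothesis dE : forall a, d a = del a + delbar a.
Hypothesis deg_le2 : forall m n x,
  deg m n x -> ~~ ((m <= 2) && (n <= 2))%N -> x = 0.

(** Booleans name the letters: through the coercion to [nat], the letter [b] has bidegree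
    [(b, ~~ b)], and the bidegree of a word is a count of booleans. *)
Let X (b : bool) := if b then del else delbar.
Let X_equiv (b : bool) : equivariant b (~~ b) (X b). Proof. by case: b. Qed.
Let XM (b : bool) : derivation (X b). Proof. by case: b. Qed.
Let w b1 b2 b3 b4 := word4 (X b1) (X b2) (X b3) (X b4).

Let word_d a : word4 d d d d a =
  w true true false false a + (w true false true false a +
  (w true false false true a + (w false true true false a +
  (w false true false true a + w false false true true a)))).
Proof.
pose x b1 b2 b3 b4 := iota (a (inord 0)) * X b1 (a (inord 1))
  * X b2 (a (inord 2)) * X b3 (a (inord 3)) * X b4 (a (inord 4)).
have x_deg (b1 b2 b3 b4 : bool) : deg (b1 + b2 + b3 + b4)
    (~~ b1 + ~~ b2 + ~~ b3 + ~~ b4) (x b1 b2 b3 b4).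
  by do 3!apply: degM (equiv_deg (X_equiv _) _);
    apply: degL; exact: equiv_deg.
(* Unless each letter occurs twice, one of them occurs at least three times, which exceeds the top
   degree 2. *)
have x0 (b1 b2 b3 b4 : bool) : (b1 + b2 + b3 + b4 != 2)%N -> x b1 b2 b3 b4 = 0.
  by move=> neq2; apply: deg_le2 (x_deg _ _ _ _) _;
    case: b1 b2 b3 b4 neq2 => -[] [] [].
have -> : word4 d d d d a = int (x true true false false +
    (x true false true false + (x true false false true +
    (x false true true false + (x false true false true +
     x false false true true))))).
  have dX b : d b = \sum_e X e b by rewrite dE big_bool.
  rewrite /word4; congr int.
  have -> : iota (a (inord 0)) * d (a (inord 1)) * d (a (inord 2))
      * d (a (inord 3)) * d (a (inord 4)) =
      \sum_b1 \sum_b2 \sum_b3 \sum_b4 x b1 b2 b3 b4.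
    rewrite !dX [iota _ * _]mulr_sumr !mulr_suml.
    apply: eq_bigr => b1 _; rewrite [iota _ * _ * _]mulr_sumr !mulr_suml.
    apply: eq_bigr => b2 _; rewrite [iota _ * _ * _ * _]mulr_sumr mulr_suml.
    by apply: eq_bigr => b3 _; rewrite mulr_sumr.
  rewrite !big_bool /=.
  rewrite (x0 true true true true) // (x0 true true true false) //.
  rewrite (x0 true true false true) // (x0 true false true true) //.
  rewrite (x0 false true true true) // (x0 true false false false) //.
  rewrite (x0 false true false false) // (x0 false false true false) //.
  rewrite (x0 false false false true) // (x0 false false false false) //.
  by rewrite !(add0r, addr0) !addrA.
have x_deg2 (b1 b2 b3 b4 : bool) : (b1 + b2 + b3 + b4 == 2)%N ->
    deg 2%N 2%N (x b1 b2 b3 b4).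
  by have := x_deg b1 b2 b3 b4; case: b1 b2 b3 b4 => -[] [] [].
have degD y z : deg 2%N 2%N y -> deg 2%N 2%N z -> deg 2%N 2%N (y + z).
  by move=> dy dz; rewrite -[y]scale1r; apply: deg_lin.
by rewrite !intD //; do ![exact: x_deg2 | apply: (degD _ _)].
Qed.

Let w_twisted_cochain (b1 b2 b3 b4 : bool) : (b1 + b2 + b3 + b4 == 2)%N ->
  twisted_cochain sigma (w b1 b2 b3 b4).
Proof.
move=> /eqP b2E; apply: (word4_twisted_cochain
  (X_equiv _) (X_equiv _) (X_equiv _) (X_equiv _)) => //.
by move: b2E; case: b1 b2 b3 b4 => -[] [] [].
Qed.

Let b_w (b1 b2 b3 b4 : bool) a : (b1 + b2 + b3 + b4 == 2)%N ->
  b_sigma sigma (w b1 b2 b3 b4) a = 0.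
Proof.
move=> /eqP b2E; apply: (b_word4 _
  (X_equiv _) (X_equiv _) (X_equiv _) (X_equiv _)) => //.
by move: b2E; case: b1 b2 b3 b4 => -[] [] [].
Qed.

Lemma word_d_cocycle :
  twisted_cocycle sigma (fun a => - word4 d d d d a).
Proof.
(* The trailing [0] gives every tail the shape [k * phi + psi] required by the linearity lemmas. *)
have -> : (fun a => - word4 d d d d a) = fun a =>
    -1 * w true true false false a + (-1 * w true false true false a +
    (-1 * w true false false true a + (-1 * w false true true false a +
    (-1 * w false true false true a + (-1 * w false false true true a + 0))))).
  by apply/funext => a; rewrite word_d; ring.
split=> [|a].
  by do 6!apply: (twisted_cochain_lin _ (w_twisted_cochain _)) => //;
    apply: twisted_cochain0.
by rewrite !b_sigma_lin b_sigma0 !b_w // !mulr0 !addr0.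
Qed.

Lemma word_holomorphic_cocycle k :
  twisted_cocycle sigma (fun a => k * word4 del del delbar delbar a +
                                  k * word4 delbar delbar del del a).
Proof.
have -> : (fun a => k * word4 del del delbar delbar a +
                    k * word4 delbar delbar del del a) = fun a =>
    k * w true true false false a + (k * w false false true true a + 0).
  by apply/funext => a; rewrite addr0.
split=> [|a].
  by do 2!apply: (twisted_cochain_lin _ (w_twisted_cochain _)) => //;
    apply: twisted_cochain0.
by rewrite !b_sigma_lin b_sigma0 !b_w // !mulr0 !addr0.
Qed.

Let derivation_defect Y a b : derivation Y -> leibniz_defect Y a b = 0.
Proof. by move=> YM; rewrite /leibniz_defect YM addrAC addrK subrr. Qed.

(** The left-hand side has coefficient 2 on the words of [phi] and -1 on the other four. These sum
    to zero, so it is a combination of differences of words that differ by one adjacent exchange;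
    each such difference is a coboundary through the defect of [deldelbar]. *)
Lemma word_d_cohomologous : exists psi : cochain A 3,
  twisted_cochain sigma psi /\ forall a,
    - word4 d d d d a - (- 3%:R * word4 del del delbar delbar a +
                         - 3%:R * word4 delbar delbar del del a) =
    b_sigma sigma psi a.
Proof.
pose g := deldelbar.
(* Up to sign, the coboundaries of these four words are, writing + for del and
   - for delbar, the differences (++--) - (+-+-), (-+-+) - (--++),
   (+-+-) - (+--+) and (-++-) - (-+-+). *)
exists (fun a => 2%:R * word3 del g delbar a + (- 2%:R * word3 delbar g del a
  + (-1 * word3 del delbar g a + (1 * word3 delbar del g a + 0)))).
have tc1 := word3_twisted_cochain del_equiv deldelbar_equiv delbar_equiv.
have tc2 := word3_twisted_cochain delbar_equiv deldelbar_equiv del_equiv.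
have tc3 := word3_twisted_cochain del_equiv delbar_equiv deldelbar_equiv.
have tc4 := word3_twisted_cochain delbar_equiv del_equiv deldelbar_equiv.
split=> [|a].
  apply: twisted_cochain_lin; first exact: tc1.
  apply: twisted_cochain_lin; first exact: tc2.
  apply: twisted_cochain_lin; first exact: tc3.
  by apply: twisted_cochain_lin; [exact: tc4 | exact: twisted_cochain0].
rewrite !b_sigma_lin b_sigma0.
rewrite (b_word3 a del_equiv deldelbar_equiv delbar_equiv) //.
rewrite (b_word3 a delbar_equiv deldelbar_equiv del_equiv) //.
rewrite (b_word3 a del_equiv delbar_equiv deldelbar_equiv) //.
rewrite (b_word3 a delbar_equiv del_equiv deldelbar_equiv) //.
rewrite !deldelbar_defect !(derivation_defect _ _ delM).
rewrite !(derivation_defect _ _ delbarM) word_d.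
have w_deg (b1 b2 b3 b4 : bool) : (b1 + b2 + b3 + b4 == 2)%N ->
    deg 2%N 2%N (iota (a (inord 0)) * X b1 (a (inord 1)) * X b2 (a (inord 2))
      * X b3 (a (inord 3)) * X b4 (a (inord 4))).
  move=> /eqP b2E; have nb2E : (~~ b1 + ~~ b2 + ~~ b3 + ~~ b4)%N = 2%N.
    by move: b2E; case: b1 b2 b3 b4 => -[] [] [].
  rewrite -[X in deg X _]b2E -[X in deg _ X]nb2E.
  by do 3!apply: degM (equiv_deg (X_equiv _) _);
    apply: degL; exact: equiv_deg (X_equiv _) _.
have wB (b1 b2 b3 b4 c1 c2 c3 c4 : bool) :
    (b1 + b2 + b3 + b4 == 2)%N -> (c1 + c2 + c3 + c4 == 2)%N ->
    int (iota (a (inord 0)) * X b1 (a (inord 1)) * X b2 (a (inord 2))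
         * X b3 (a (inord 3)) * X b4 (a (inord 4))
       - iota (a (inord 0)) * X c1 (a (inord 1)) * X c2 (a (inord 2))
         * X c3 (a (inord 3)) * X c4 (a (inord 4))) =
    w b1 b2 b3 b4 a - w c1 c2 c3 c4 a.
  by move=> db dc; rewrite intB //; apply: (w_deg).
have int0 : int 0 = 0.
  (* Since [int] is linear only in bidegree (2,2), 0 must first be placed there, as -x + x for one
     of the words. *)
  have deg0 : deg 2%N 2%N 0.
    have dw := w_deg true true false false isT.
    by have := deg_lin (-1) dw dw; rewrite scaleN1r addNr.
  by have := intL (-1) deg0 deg0; rewrite scaler0 addr0 mulN1r addNr.
rewrite !(mulrBr, mulrBl, mulr0, mul0r, mulrA).
rewrite (wB true true false false true false true false) //.
rewrite (wB false true false true false false true true) //.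
rewrite (wB true false true false true false false true) //.
rewrite (wB false true true false false true false true) //.
rewrite int0 -/(w true true false false a) -/(w false false true true a).
ring.
Qed.
End Words.

(** * The presented calculus: linearity, products and bidegrees *)

Section Calculus.
Variables (R : realType) (q : R) (S : SUq3_structure q).
Variables (hq : 0 < q < 1) (c c' : R[i]).

Local Notation C := R[i].
Local Notation A := (CP2 S).
Local Notation W := (Omega S hq c c').
Local Notation iota := (@Defs.iota R q S hq c c').
Local Notation form1 := (@Defs.form1 R q S hq c c').
Local Notation del := (@Defs.del R q S hq c c').
Local Notation delbar := (@Defs.delbar R q S hq c c').
Local Notation d := (@Defs.d R q S hq c c').

Lemma iota_linear (k : C) (a b : A) : iota (k *: a + b) = k *: iota a + iota b.
Proof.
rewrite /Defs.iota !presgenE -linearP; apply: quot_pi_rel.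
exact: Omega_fun_linear.
Qed.

Lemma iota1 : iota 1 = 1.
Proof.
rewrite /Defs.iota presgenE -(rmorph1 (quot_pi _)); apply: quot_pi_rel.
exact: Omega_fun1.
Qed.

Lemma iotaM (a b : A) : iota (a * b) = iota a * iota b.
Proof.
rewrite /Defs.iota !presgenE -rmorphM; apply: quot_pi_rel.
exact: Omega_funM.
Qed.

Lemma form1_linear (k : C) (v w : Form1 S) :
  form1 (k *: v + w) = k *: form1 v + form1 w.
Proof.
rewrite /Defs.form1 !presgenE -linearP; apply: quot_pi_rel.
exact: Omega_form_linear.
Qed.

Lemma form1_lmulE (a : A) (v : Form1 S) :
  form1 (form1_lmul a v) = iota a * form1 v.
Proof.
rewrite /Defs.form1 /Defs.iota !presgenE -rmorphM; apply: quot_pi_rel.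
exact: Omega_lmul.
Qed.

Lemma form_lmul0 w (a : A) : form_lmul a (0 : Defs.form S w) = 0.
Proof. by apply/val_inj; rewrite /= !mulr0. Qed.

Lemma d_split (a : A) : d a = del a + delbar a.
Proof.
rewrite /Defs.d /Defs.del /Defs.delbar /extd -[form1 (_, 0)]scale1r.
rewrite -form1_linear scale1r; congr (form1 (_, _)); first by rewrite addr0.
by rewrite add0r.
Qed.

(** Elements of [in_Omega] are built by multiplying by 1-forms on the left, so a function is
    absorbed into the leftmost form by the bimodule relation. *)
Lemma in_Omega_iotaM (a : A) m n (x : W) :
  in_Omega m n x -> in_Omega m n (iota a * x).
Proof.
elim=> {m n x} [b|m n v x x_in _|m n v x x_in _|m n x y _ ax _ ay].
- by rewrite -iotaM; apply: in_Omega00.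
- rewrite mulrA -form1_lmulE /form1_lmul /= form_lmul0.
  exact: in_Omega10.
- rewrite mulrA -form1_lmulE /form1_lmul /= form_lmul0.
  exact: in_Omega01.
- by rewrite mulrDr; apply: in_OmegaD.
Qed.

Lemma in_OmegaM m n m' n' (x y : W) :
  in_Omega m n x -> in_Omega m' n' y -> in_Omega (m + m') (n + n') (x * y).
Proof.
move=> x_in y_in.
elim: x_in => {m n x} [a|m n v x _ xy|m n v x _ xy|m n x z _ xy _ zy].
- exact: in_Omega_iotaM.
- by rewrite -mulrA; apply: in_Omega10.
- by rewrite -mulrA; apply: in_Omega01.
- by rewrite mulrDl; apply: in_OmegaD.
Qed.

Lemma in_Omega_lin m n (k : C) (x y : W) :
  in_Omega m n x -> in_Omega m n y -> in_Omega m n (k *: x + y).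
Proof.
move=> x_in y_in; apply: in_OmegaD => //.
(* [in_Omega] is generated without scalars; a scalar is realized as multiplication by a constant
   function. *)
have -> : k *: x = iota (k *: 1) * x.
  have i0 : iota 0 = 0.
    by have := iota_linear (-1) 0 0; rewrite scaler0 addr0 scaleN1r addNr.
  by rewrite -[k *: 1]addr0 iota_linear i0 addr0 iota1 -scalerAl mul1r.
exact: in_Omega_iotaM.
Qed.

Lemma del_in_Omega (a : A) : in_Omega 1 0 (del a).
Proof. by rewrite -[del a]mulr1 -iota1; apply/in_Omega10/in_Omega00. Qed.

Lemma delbar_in_Omega (a : A) : in_Omega 0 1 (delbar a).
Proof. by rewrite -[delbar a]mulr1 -iota1; apply/in_Omega01/in_Omega00. Qed.

(** * Leibniz rules for functions and for the second-order operator *)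

Section Dolbeault.
Variables (D Db : W -> W) (D_Db : is_dolbeault D Db).

Lemma del_linear (k : C) (a b : A) : del (k *: a + b) = k *: del a + del b.
Proof. by rewrite -!(dolb_fun D_Db) iota_linear (dolb_linear D_Db). Qed.

Lemma delbar_linear (k : C) (a b : A) :
  delbar (k *: a + b) = k *: delbar a + delbar b.
Proof. by rewrite -!(dolbbar_fun D_Db) iota_linear (dolbbar_linear D_Db). Qed.

Lemma del_derivation : derivation iota del.
Proof.
move=> a b; rewrite -!(dolb_fun D_Db) iotaM.
by rewrite (dolb_leibniz D_Db _ (in_Omega00 hq c c' a)) mul1r.
Qed.

Lemma delbar_derivation : derivation iota delbar.
Proof.
move=> a b; rewrite -!(dolbbar_fun D_Db) iotaM.
by rewrite (dolbbar_leibniz D_Db _ (in_Omega00 hq c c' a)) mul1r.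
Qed.

(** [D] passes [a] without a sign but passes the 1-form [delbar a] with a minus sign, so the two
    cross terms come with opposite signs. *)
Lemma deldelbar_leibniz (a b : A) :
  leibniz_defect iota (D \o delbar) a b = del a * delbar b - delbar a * del b.
Proof.
have DD x y : D (x + y) = D x + D y.
  by have := dolb_linear D_Db 1 x y; rewrite !scale1r.
rewrite /leibniz_defect /= delbar_derivation DD.
rewrite (dolb_leibniz D_Db _ (delbar_in_Omega a)).
rewrite (dolb_leibniz D_Db _ (in_Omega00 hq c c' a)) !(dolb_fun D_Db).
rewrite expr1 mulN1r mul1r -[LHS]addrA -opprD [X in _ + X - _]addrC addrACA.
by rewrite [LHS]addrAC subrr add0r addrC.
Qed.

(** * Equivariance under the modular element *)

Section Action.
Variables (act : Uq q -> W -> W) (act_ext : is_Omega_action D Db act).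

(** [UKmod] is a product of group-like elements, hence acts by an algebra morphism. *)
Lemma act_UKmodM (x y : W) :
  act (UKmod q) (x * y) = act (UKmod q) x * act (UKmod q) y.
Proof.
have KM i u v : act (UKinv q i) (u * v) = act (UKinv q i) u * act (UKinv q i) v.
  by rewrite (act_mul act_ext) big_seq1.
by rewrite /UKmod !exprS expr0 mulr1 !(actM act_ext) !KM.
Qed.

Lemma act_del h (a : A) : act h (del a) = del (CP2_lact h a).
Proof. by rewrite -!(dolb_fun D_Db) (act_dolb act_ext) (act_fun act_ext). Qed.

Lemma act_delbar h (a : A) : act h (delbar a) = delbar (CP2_lact h a).
Proof.
by rewrite -!(dolbbar_fun D_Db) (act_dolbbar act_ext) (act_fun act_ext).
Qed.

Lemma del_equivariant :
  equivariant (@sigma R q S) (@in_Omega _ _ S hq c c') (act (UKmod q)) 1 0 del.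
Proof.
by split; [exact: del_linear | exact: del_in_Omega | exact: act_del].
Qed.

Lemma delbar_equivariant :
  equivariant (@sigma R q S) (@in_Omega _ _ S hq c c') (act (UKmod q)) 0 1
    delbar.
Proof.
by split; [exact: delbar_linear | exact: delbar_in_Omega | exact: act_delbar].
Qed.

Lemma deldelbar_equivariant :
  equivariant (@sigma R q S) (@in_Omega _ _ S hq c c') (act (UKmod q)) 1 1
    (D \o delbar).
Proof.
split=> [k a b|a|a] /=.
- by rewrite delbar_linear (dolb_linear D_Db).
- exact: (dolb_bidegree D_Db (delbar_in_Omega a)).
- by rewrite (act_dolb act_ext) act_delbar.
Qed.

End Action.
End Dolbeault.

(** On the projective plane the right half of the modular automorphism is trivial, so that [sigmaSU]
    restricts to [sigma]. *)
Lemma ract_UKmod (a : A) : ract S (val a) (UKmod q) = val a.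
Proof.
have [_ aKi _ _] := CP2_S5 a; have [_ aW] := CP2P a.
have actKK b i : ract S (ract S b (UK q i)) (UKinv q i) = b.
  by rewrite -ractM (Uq_relP (UqKV _ _ _ _ _ i)) ract1.
(* Invariance under K_1 and K_1 K_2^2 only gives that K_2^2 fixes [a]. Thus K_2 and its inverse send
   [a] to the same [b], and (K_1 K_2)^-1 exchanges [a] and [b]; its fourth power fixes [a]. *)
have [aK _ _ _] := CP2_S5 a; set b := ract S (val a) (UK q 1).
have aKi1 : ract S (val a) (UKinv q 1) = b.
  by rewrite -[in LHS]aW ractM aK expr2 ractM actKK.
have bKi0 : ract S b (UKinv q 0) = b.
  rewrite -[RHS](actKK _ 0) /b -(ractM S _ (UK q 1) (UK q 0)).
  by rewrite (Uq_relP (UqKK _ _ _ _ _ 1 0)) ractM aK.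
have aKi10 : ract S (val a) (UKinv q 1 * UKinv q 0) = b.
  by rewrite ractM aKi1.
have bKi10 : ract S b (UKinv q 1 * UKinv q 0) = val a.
  by rewrite ractM actKK.
rewrite /UKmod !exprS expr0 mulr1 !ractM -!(ractM _ _ (UKinv q 1)).
by rewrite !(aKi10, bKi10).
Qed.

(** * The integral as an invariant twisted trace *)

Section Integral.
Variables (act : Uq q -> W -> W) (omega : W).
Variables (omega_vol : is_volume_form act omega) (h : SUq3 q -> C).

Local Notation int := (integral h omega).

(** [integral] selects some coefficient of [omega]; the uniqueness in [vol_basis] forces the
    selected one to be [a]. *)
Lemma integralE (a : A) : int (iota a * omega) = h (val a).
Proof.
have a_in := in_Omega_iotaM a (vol_bidegree omega_vol).
have [b [_ b_uniq]] := vol_basis omega_vol a_in.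
congr (h (val _)); apply: xget_unique => //= y /b_uniq <-.
exact: b_uniq.
Qed.

Hypothesis h_linear : forall (k : C) x y, h (k *: x + y) = k * h x + h y.

Lemma integral_linear (k : C) (x y : W) : in_Omega 2 2 x -> in_Omega 2 2 y ->
  int (k *: x + y) = k * int x + int y.
Proof.
move=> /(vol_basis omega_vol)[a [-> _]] /(vol_basis omega_vol)[b [-> _]].
by rewrite scalerAl -mulrDl -iota_linear !integralE -h_linear.
Qed.

Hypothesis h_modular : forall x y, h (x * y) = h (sigmaSU S y * x).

Let sigmaSU_val (a : A) : sigmaSU S (val a) = val (sigma a).
Proof. by rewrite /sigmaSU lactC ract_UKmod. Qed.

(** Centrality of [omega] moves the function next to the coefficient, where the modular property of
    [h] applies. *)
Lemma integral_trace (x : W) (a : A) : in_Omega 2 2 x ->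
  int (x * iota a) = int (iota (sigma a) * x).
Proof.
move=> /(vol_basis omega_vol)[b [-> _]].
rewrite -mulrA (vol_central omega_vol) !mulrA -!iotaM !integralE.
by rewrite [LHS]h_modular sigmaSU_val.
Qed.

Lemma integral_act_UKmod (D Db : W -> W) (x : W) :
  is_Omega_action D Db act -> in_Omega 2 2 x -> int (act (UKmod q) x) = int x.
Proof.
move=> act_ext /(vol_basis omega_vol)[a [-> _]].
rewrite (act_UKmodM act_ext) (act_fun act_ext) (vol_invariant omega_vol).
have -> : counit (UKmod q) = 1.
  by rewrite rmorphXn rmorphM /= !counit_gen mulr1 expr1n.
(* The modular property with first factor 1 gives the invariance of [h] under [sigma]. *)
rewrite scale1r !integralE -[val a in RHS]mul1r h_modular mulr1.
by rewrite sigmaSU_val.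
Qed.

End Integral.
End Calculus.

(** * Specialization to the quantum projective plane *)

Theorem proposition6p2 (R : realType) (q : R) (hq : 0 < q < 1)
    (S : SUq3_structure q)
    (h : SUq3 q -> R[i]) (h_haar : is_haar_state S h)
    (h_modular : forall x y, h (x * y) = h (sigmaSU S y * x))
    (c c' : R[i]) (c_neq0 : c != 0) (c'_neq0 : c' != 0)
    (Omega_grading : Omega_bigraded S hq c c')
    (D Db : Omega S hq c c' -> Omega S hq c c') (D_Db : is_dolbeault D Db)
    (act : Uq q -> Omega S hq c c' -> Omega S hq c c')
    (act_ext : is_Omega_action D Db act)
    (omega : Omega S hq c c') (omega_vol : is_volume_form act omega) :
  twisted_cocycle (@sigma R q S) (tau h omega) /\
  twisted_cocycle (@sigma R q S) (phi h omega) /\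
  exists psi : cochain (CP2 S) 3,
    twisted_cochain (@sigma R q S) psi /\
    forall a : 'I_5 -> CP2 S,
      tau h omega a - phi h omega a = b_sigma (@sigma R q S) psi a.
Proof.
have intL := integral_linear omega_vol (haar_linear h_haar).
have int_trace := integral_trace omega_vol h_modular.
have int_act x := integral_act_UKmod omega_vol h_modular (x := x) act_ext.
have actM := act_UKmodM act_ext.
have act_iota a := act_fun act_ext (UKmod q) a.
have del_eq := del_equivariant D_Db act_ext.
have delbar_eq := delbar_equivariant D_Db act_ext.
have deldelbar_eq := deldelbar_equivariant D_Db act_ext.
have delM := del_derivation D_Db.
have delbarM := delbar_derivation D_Db.
have [deg_le2 _] := Omega_grading.
(* Here [theta] is the action of [UKmod], [deldelbar] is [D \o delbar], and [tau] and [phi] unfold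
   to combinations of [word4]. *)
split; last split.
- exact: (word_d_cocycle (@iota_linear R q S hq c c') (@iotaM _ _ _ _ _ _)
    (@in_Omega00 _ _ _ _ _ _) (@in_OmegaM _ _ _ _ _ _)
    (@in_Omega_lin _ _ _ _ _ _) actM act_iota intL int_trace int_act
    del_eq delbar_eq delM delbarM (@d_split _ _ _ _ _ _) deg_le2).
- exact: (word_holomorphic_cocycle (@iota_linear R q S hq c c')
    (@iotaM _ _ _ _ _ _)
    (@in_Omega00 _ _ _ _ _ _) (@in_OmegaM _ _ _ _ _ _)
    actM act_iota intL int_trace int_act
    del_eq delbar_eq delM delbarM (- 3%:R)).
exact (word_d_cohomologous (@iota_linear R q S hq c c')
    (@iotaM _ _ _ _ _ _)
    (@in_Omega00 _ _ _ _ _ _) (@in_OmegaM _ _ _ _ _ _)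
    (@in_Omega_lin _ _ _ _ _ _) actM act_iota intL int_trace int_act
    del_eq delbar_eq deldelbar_eq delM delbarM (deldelbar_leibniz D_Db)
    (@d_split _ _ _ _ _ _) deg_le2).
Qed.
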